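(* Let $S$ be a closed subset of the unit square $X\times Y$, where $X=Y=[0,1]$. Then $S$ is the support of a permuton if and only if $S$ is compliant and every occupied cell with rational corners is shavable.
   Context: A permuton is a Borel probability measure on $[0,1]^2$ both of whose marginals are Lebesgue measure $\lambda$ on $[0,1]$. All sets whose measure is mentioned are assumed Lebesgue measurable (so quantifiers over sets $U$ range over measurable $U$ for which the neighborhoods whose measure is taken are measurable). For $U\subseteq X$ put $N(U) := \{y\in Y : (x,y)\in S\text{ for some }x\in U\}$. The set $S$ is compliant if $\lambda(N(U))\ge\lambda(U)$ for every measurable $U\subseteq X$. More generally, for finite measures $\alpha'$ on $X$ and $\beta'$ on $Y$ of the same total mass, the system consisting of $S$ with marginals $\alpha'$ and $\beta'$ is compliant if $\beta'(N(U))\ge\alpha'(U)$ for every measurable $U\subseteq X$. A cell is a square $C=I\times J$, where $I\subseteq X$ and $J\subseteq Y$ are closed intervals of equal positive length. A cell $C$ is occupied if its interior (taken in the space $X\times Y$) intersects $S$. An occupied cell $C$ is shavable if there is a nonzero finite Borel measure $\rho$ on $S\cap C$, whose $X$-marginal $\alpha$ and $Y$-marginal $\beta$ satisfy $\alpha\le\lambda$ and $\beta\le\lambda$, such that the system consisting of $S$ with marginals $\lambda-\alpha$ and $\lambda-\beta$ is compliant. *)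

(* Defs.v *)
From HB Require Import structures.
From mathcomp Require Import all_boot all_order all_algebra.
From mathcomp Require Import all_classical all_reals all_analysis.
From mathcomp Require Import measurable_realfun.
Set Implicit Arguments.
Unset Strict Implicit.
Unset Printing Implicit Defensive.
Import Order.TTheory GRing.Theory Num.Theory.
Import numFieldNormedType.Exports.
Local Open Scope classical_set_scope.
Local Open Scope ring_scope.

(* X = Y = [0, 1] and X x Y are subsets of R and R * R. A measure on one of
   them is a measure on R or R * R that vanishes off it; the library's
   sigma-algebras on R and R * R are the Borel ones. *)
Definition unit_itv (R : realType) : set R := `[0, 1].

Definition unit_square (R : realType) : set (R * R) :=
  @unit_itv R `*` @unit_itv R.

(* Lebesgue measure on [0, 1]. *)
Definition lambda (R : realType) : set R -> \bar R :=
  mrestr (@lebesgue_measure R) (measurable_itv `[0, 1]).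

Definition Xmarginal (R : realType) (mu : set (R * R) -> \bar R) :
  set R -> \bar R := pushforward mu (fst : R * R -> R).

Definition Ymarginal (R : realType) (mu : set (R * R) -> \bar R) :
  set R -> \bar R := pushforward mu (snd : R * R -> R).

Definition is_permuton (R : realType) (mu : probability (R * R)%type R) : Prop :=
  [/\ mu (~` @unit_square R) = 0%E,
      forall A : set R, measurable A -> Xmarginal mu A = lambda A
    & forall A : set R, measurable A -> Ymarginal mu A = lambda A].

Definition msupport (R : realType) (mu : set (R * R) -> \bar R) : set (R * R) :=
  [set p | forall V : set (R * R), open V -> V p -> (0 < mu V)%E].

(* This generator, the unions of a Borel set and a subset of a Borel null set,
   is already the Lebesgue sigma-algebra. *)
Definition Lebesgue_measurable (R : realType) (U : set R) : Prop :=
  completed_algebra_gen (@lebesgue_measure R) U.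

Definition nbhd (R : realType) (S : set (R * R)) (U : set R) : set R :=
  [set y | exists2 x, U x & S (x, y)].

(* alpha and beta are given on Borel sets only, and are only used when they are
   finite Borel measures <= lambda. The outer measure of such a measure agrees
   on Lebesgue measurable sets with its completion; this gives a meaning to
   alpha U and beta (N(U)) for sets that need not be Borel. *)
Definition compliant (R : realType) (S : set (R * R))
    (alpha beta : set R -> \bar R) : Prop :=
  forall U : set R, U `<=` @unit_itv R ->
    Lebesgue_measurable U -> Lebesgue_measurable (nbhd S U) ->
    ((alpha^*)%mu U <= (beta^*)%mu (nbhd S U))%E.

Definition cell (R : realType) (a b c d : R) : set (R * R) :=
  `[a, b] `*` `[c, d].

Definition is_cell (R : realType) (a b c d : R) : Prop :=
  [/\ [&& 0 <= a, a < b & b <= 1], [&& 0 <= c, c < d & d <= 1]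
    & b - a = d - c].

(* The interior is relative to the unit square. *)
Definition occupied (R : realType) (S C : set (R * R)) : Prop :=
  S `&` interior (C : set (subspace (@unit_square R))) !=set0.

Definition shavable (R : realType) (S C : set (R * R)) : Prop :=
  exists rho : {finite_measure set (R * R)%type -> \bar R},
    [/\ rho (~` (S `&` C)) = 0%E,
        rho setT != 0%E,
        forall A : set R, measurable A -> (Xmarginal rho A <= lambda A)%E,
        forall A : set R, measurable A -> (Ymarginal rho A <= lambda A)%E
      & compliant S (@lambda R \- Xmarginal rho)%E
                    (@lambda R \- Ymarginal rho)%E].

(* Main.v *)
(** The core is a Strassen-type statement: if alpha, beta <= lambda have the same
    mass and alpha(U) <= beta(N(U)) for closed U, then some measure carried by the
    closed set S has marginals alpha and beta. At scale 2^-n, Hall's condition for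
    the dyadic intervals gives a transport plan supported on the squares that meet
    S; these plans converge along an ultrafilter to consistent masses of all dyadic
    squares, and cutting a real interval into nested pieces of these lengths
    realizes the masses as the image of Lebesgue measure under a measurable map
    into the square. The image lives on S because S is closed, and it has the right
    marginals because boundary effects at scale 2^-k cost at most 2^-k (alpha and
    beta are dominated by Lebesgue measure).

    A shaved cell C then gives a measure on S with uniform marginals and positive
    mass on C, and a mixture over the countably many rational cells has support S.
    Conversely, the restriction of a permuton to a cell shaves that cell. *)
Require Import Defs.
From HB Require Import structures.
From mathcomp Require Import all_boot all_order all_algebra.
From mathcomp Require Import all_classical all_reals all_analysis.
From mathcomp Require Import measurable_realfun.
From mathcomp Require Import ring lra zify.
Set Implicit Arguments.
Unset Strict Implicit.
Unset Printing Implicit Defensive.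
Import Order.TTheory GRing.Theory Num.Theory.
Import numFieldNormedType.Exports.
Local Open Scope ring_scope.

(** * The finite transportation problem *)

Section Transport.
Variables (R : realFieldType) (I J : finType).
Implicit Types (a : I -> R) (b : J -> R) (e : I -> J -> bool) (A : {set I}).

(** Surplus in Hall's condition: demand reachable from [A] minus supply of [A]. A set is tight when
    it vanishes. *)
Definition slack a b e A : R :=
  \sum_(j | [exists i in A, e i j]) b j - \sum_(i in A) a i.

Definition hall a b e : Prop := forall A, 0 <= slack a b e A.

(** Hall's condition is applied to [A :\ i0], which has the supply of [A] and uses only surviving
    edges. *)
Lemma hall_drop_row a b e i0 : hall a b e -> (forall j, 0 <= b j) ->
  a i0 = 0 -> hall a b (fun i j => (i != i0) && e i j).
Proof.
move=> H b0 ai0 A; have := H (A :\ i0); rewrite /slack => /le_trans; apply.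
rewrite lerB//.
  rewrite [leRHS]big_mkcond/= [leLHS]big_mkcond/=; apply: ler_sum => j _.
  case: ifPn => [/existsP[i /andP[]]|_]; last by case: ifP.
  rewrite !inE => /andP[i1 i2] i3; case: ifPn => // /negP[].
  by apply/existsP; exists i; rewrite i2 i1.
rewrite [leLHS]big_mkcond/= [leRHS]big_mkcond/=; apply: ler_sum => i _.
by rewrite !inE; have [->|]//= := eqVneq i i0; rewrite ai0; case: ifP.
Qed.

Lemma hall_drop_col a b e j0 : hall a b e -> b j0 = 0 ->
  hall a b (fun i j => (j != j0) && e i j).
Proof.
move=> H bj0 A; have := H A; rewrite /slack => /le_trans; apply.
rewrite lerB// [leRHS]big_mkcond/= [leLHS]big_mkcond/=; apply: ler_sum => j _.
case: ifPn => [/existsP[i /andP[iA eij]]|jA].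
  have [->|jj0] := eqVneq j j0; first by rewrite bj0; case: ifP.
  case: ifPn => // /negP[]; apply/existsP; exists i.
  by rewrite iA eij.
case: ifPn => // /existsP[i /and3P[iA jj0 eij]].
by case/negP: jA; apply/existsP; exists i; rewrite iA.
Qed.

(** Uncrossing: dropping the edges that enter the neighborhood of [T] from outside [T] gives [A] the
    slack of [A :&: T] plus that of [A :|: T] minus that of [T], and the last is zero. *)
Lemma hall_split a b e T : hall a b e -> slack a b e T = 0 ->
  hall a b (fun i j => ((i \in T) == [exists k in T, e k j]) && e i j).
Proof.
move=> H tT A; have H1 := H (A :&: T); have H2 := H (A :|: T).
move: H1 H2 tT; rewrite /slack.
have -> : \sum_(i in A :|: T) a i = \sum_(i in T) a i + \sum_(i in A :\: T) a i.
  rewrite (bigID (mem T))/=; congr (_ + _); apply: eq_bigl => i; rewrite !inE.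
    by case: (i \in T); rewrite ?orbT ?andbF.
  by case: (i \in T); rewrite ?orbT ?orbF ?andbF ?andbT.
have -> : \sum_(i in A) a i = \sum_(i in A :&: T) a i + \sum_(i in A :\: T) a i.
  by rewrite (bigID (mem T))/=; congr (_ + _); apply: eq_bigl => i; rewrite !inE// andbC.
have -> : \sum_(j | [exists i in A :|: T, e i j]) b j =
  \sum_(j | [exists i in T, e i j]) b j +
  \sum_(j | [exists i in A :\: T, e i j] && ~~ [exists i in T, e i j]) b j.
  rewrite (bigID [pred j | [exists i in T, e i j]])/=; congr (_ + _); apply: eq_bigl => j.
    apply/andP/idP => [[]//|jT]; split => //.
    by move/existsP: jT => [i /andP[iT eij]]; apply/existsP; exists i; rewrite inE iT eij orbT.
  apply/andP/andP => -[/existsP[i /andP[iA eij]] jT]; split => //; apply/existsP;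
    exists i; rewrite eij andbT.
    move: iA; rewrite !inE => /orP[->|iT]; rewrite ?andbT.
      by apply: contra jT => iT; apply/existsP; exists i; rewrite iT.
    by case/negP: jT; apply/existsP; exists i; rewrite iT.
  by move: iA; rewrite !inE => /andP[_ ->].
have -> : \sum_(j | [exists i in A,
     ((i \in T) == [exists k in T, e k j]) && e i j]) b j =
  \sum_(j | [exists i in A :&: T, e i j]) b j +
  \sum_(j | [exists i in A :\: T, e i j] && ~~ [exists i in T, e i j]) b j.
  rewrite (bigID [pred j | [exists i in T, e i j]])/=; congr (_ + _); apply: eq_bigl => j.
    apply/andP/existsP => [[/existsP[i /and3P[iA /eqP iT eij]] jT]|[i]].
      by exists i; rewrite inE iA iT jT eij.
    rewrite inE => /andP[/andP[iA iT] eij].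
    have jT : [exists i in T, e i j] by apply/existsP; exists i; rewrite iT.
    by split => //; apply/existsP; exists i; rewrite iA eij iT jT.
  apply/andP/andP => -[/existsP[i /andP[iA]]].
    move=> /andP[/eqP iT eij] jT; split => //; apply/existsP; exists i.
    by rewrite inE iT jT iA eij.
  move=> eij jT; split => //; apply/existsP; exists i; move: iA; rewrite inE => /andP[iT ->].
  by rewrite eij (negbTE iT) (negbTE jT).
lra.
Qed.

(** A set containing [i0] also reaches [j0], so shipping [eps] can change only the slacks of sets
    that reach [j0] without containing [i0]. The second conclusion serves to show that a minimizing
    set becomes tight. *)
Lemma hall_push a b e i0 j0 eps : e i0 j0 -> hall a b e ->
  (forall A, i0 \notin A -> [exists i in A, e i j0] -> eps <= slack a b e A) ->
  hall (fun i => a i - eps *+ (i == i0)) (fun j => b j - eps *+ (j == j0)) e /\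
  forall A, i0 \notin A -> [exists i in A, e i j0] ->
  slack (fun i => a i - eps *+ (i == i0)) (fun j => b j - eps *+ (j == j0)) e A
  = slack a b e A - eps.
Proof.
move=> e0 H Heps.
have sumB (K : finType) (P : pred K) (c : K -> R) (k : K) :
    \sum_(j | P j) (c j - eps *+ (j == k)) = \sum_(j | P j) c j - eps *+ P k.
  rewrite sumrB; congr (_ - _).
  under eq_bigr do rewrite -mulr_natr.
  rewrite -mulr_sumr -natr_sum -[RHS]mulr_natr; congr (_ * _%:R).
  rewrite -big_mkcondr/= sum1_card; case: (boolP (P k)) => Pk /=.
    rewrite -(card1 k); apply: eq_card => j; rewrite unfold_in/= inE.
    by case: eqVneq => [->|]; rewrite ?andbT ?andbF.
  apply: eq_card0 => j; rewrite unfold_in/=.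
  by case: eqVneq => [->|]; rewrite ?(negbTE Pk) ?andbF.
split=> [|A iA jA]; last by rewrite /slack !sumB (negbTE iA) jA/= mulr0n mulr1n; lra.
move=> A; rewrite /slack !sumB.
have [iA|iA] := boolP (i0 \in A).
  have -> : [exists i in A, e i j0] by apply/existsP; exists i0; rewrite iA.
  by have := H A; rewrite /slack; lra.
have [jA|jA] := boolP [exists i in A, e i j0].
  by have := Heps A iA jA; rewrite /slack/= mulr1n mulr0n; lra.
by have := H A; rewrite /slack/= mulr0n; lra.
Qed.

(* Ship as much as Hall's condition allows along the edge (i0, j0). Then a_i0 or
   b_j0 vanishes or a set becomes tight, and in each case the edge can be dropped. *)
Lemma hall_edge a b e i0 j0 : e i0 j0 -> hall a b e ->
  (forall i, 0 <= a i) -> (forall j, 0 <= b j) ->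
  exists eps (e' : I -> J -> bool),
    let a' := fun i => a i - eps *+ (i == i0) in
    let b' := fun j => b j - eps *+ (j == j0) in
    [/\ 0 <= eps, eps <= a i0, eps <= b j0, hall a' b' e' &
      (forall i j, e' i j -> e i j) /\ ~~ e' i0 j0].
Proof.
move=> e0 H a0 b0.
(* Sets whose slack runs out before the supply of [i0] or the demand of [j0] does. *)
pose P A := [&& i0 \notin A, [exists i in A, e i j0] &
  slack a b e A < Num.min (a i0) (b j0)].
have [/existsP[A0 PA0]|/negP noP] := boolP [exists A, P A].
  have [A /and3P[iA jA sA] minA] := arg_minP (slack a b e) PA0.
  have [] := @hall_push a b e i0 j0 (slack a b e A) e0 H.
    (* If [B] is outside [P], its slack is at least the minimum of [a i0] and [b j0], hence at least
       that of the minimizer [A]. *)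
    move=> B iB jB; have [sB|sB] := ltP (slack a b e B) (Num.min (a i0) (b j0)).
      by apply: minA; rewrite /P iB jB.
    by apply: le_trans sB; exact: ltW.
  move=> H' /(_ A iA jA); rewrite subrr => tA.
  exists (slack a b e A), (fun i j => ((i \in A) == [exists k in A, e k j]) && e i j).
  split => /=.
  - exact: H.
  - by move: sA; rewrite lt_min => /andP[/ltW].
  - by move: sA; rewrite lt_min => /andP[_ /ltW].
  - exact: hall_split.
  - by split; [move=> i j /andP[]|rewrite (negbTE iA) jA].
have Heps A : i0 \notin A -> [exists i in A, e i j0] ->
    Num.min (a i0) (b j0) <= slack a b e A.
  move=> iA jA; rewrite leNgt; apply/negP => sA; apply: noP.
  by apply/existsP; exists A; rewrite /P iA jA.
have [H' _] := hall_push e0 H Heps.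
have [ab|ba] := leP (a i0) (b j0).
- rewrite (min_idPl ab) in H'.
  exists (a i0), (fun i j => (i != i0) && e i j); split => //=.
    apply: hall_drop_row => // [j|]; last by rewrite eqxx mulr1n subrr.
    by have [->|_] := eqVneq j j0; rewrite ?mulr1n ?mulr0n ?subr0 ?subr_ge0.
  by split=> [i j /andP[]//|]; rewrite eqxx.
- rewrite (min_idPr (ltW ba)) in H'.
  exists (b j0), (fun i j => (j != j0) && e i j); split => //=; first exact: ltW.
    by apply: hall_drop_col => //; rewrite eqxx mulr1n subrr.
  by split=> [i j /andP[]//|]; rewrite eqxx.
Qed.

(** Induction on the number of edges: [hall_edge] ships along one edge and removes it, and the
    shipment is added back to the smaller plan. *)
Theorem transportation a b e :
  (forall i, 0 <= a i) -> (forall j, 0 <= b j) ->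
  \sum_i a i = \sum_j b j -> hall a b e ->
  exists m : I -> J -> R,
    [/\ forall i j, 0 <= m i j, forall i j, 0 < m i j -> e i j,
        forall i, \sum_j m i j = a i & forall j, \sum_i m i j = b j].
Proof.
have [n] := ubnP #|[set p : I * J | e p.1 p.2]|.
elim: n => // n IH in a b e *; move=> en a0 b0 ab H.
have [/existsP[[i0 j0] /= e0]|/negP noe] := boolP [exists p : I * J, e p.1 p.2]; last first.
  have s0 : \sum_i a i = 0.
    apply/le_anti; rewrite sumr_ge0// andbT.
    (* Without edges nothing is reachable, so Hall's condition for all of [I] forces the total
       supply to be zero. *)
    have := H [set: I]%SET; rewrite /slack subr_ge0 [X in _ <= X]big_pred0; last first.
      move=> j; apply/negbTE/negP => /existsP[i /andP[_ eij]].
      by apply: noe; apply/existsP; exists (i, j).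
    by under eq_bigl do rewrite inE.
  exists (fun _ _ => 0); split => // [i j|i|j]; rewrite ?ltxx// big1//.
    by apply/esym/(psumr_eq0P _ s0).
  by rewrite ab in s0; apply/esym/(psumr_eq0P _ s0).
have [eps [e' /= [eps0 epsa epsb H' [e'e ne0]]]] := hall_edge e0 H a0 b0.
have [|||| m [m0 me ma mb]] := IH _ _ e' _ _ _ _ H'.
- rewrite -ltnS; apply: leq_trans en; rewrite ltnS; apply: proper_card.
  apply/properP; split; first by apply/fintype.subsetP => p; rewrite !inE; exact: e'e.
  by exists (i0, j0); rewrite inE.
- by move=> i; have [->|_] := eqVneq i i0; rewrite ?mulr1n ?mulr0n ?subr0 ?subr_ge0.
- by move=> j; have [->|_] := eqVneq j j0; rewrite ?mulr1n ?mulr0n ?subr0 ?subr_ge0.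
- rewrite !sumrB ab; congr (_ - _).
  by rewrite (bigD1 i0)//= (bigD1 j0)//= !eqxx !big1 ?addr0// => k /negbTE ->.
exists (fun i j => m i j + eps *+ ((i == i0) && (j == j0))); split.
- by move=> i j; rewrite addr_ge0// mulrn_wge0.
- move=> i j; case: (i =P i0) => [->|_]; case: (j =P j0) => [->|_] //=;
    by rewrite mulr0n addr0 => /me/e'e.
- move=> i; rewrite big_split/= ma (bigD1 j0)//= eqxx andbT big1 ?addr0 ?subrK//.
  by move=> j /negbTE ->; rewrite andbF.
- move=> j; rewrite big_split/= mb (bigD1 i0)//= eqxx big1 ?addr0 ?subrK//.
  by move=> i /negbTE ->.
Qed.

End Transport.

Local Open Scope classical_set_scope.
Local Open Scope ring_scope.

(** * Dyadic intervals *)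

Lemma div_exp2S d x : (x %/ 2 ^ d.+1)%N = (x %/ 2 ^ d)./2.
Proof. by rewrite expnSr divnMA divn2. Qed.

Lemma half_eq x i : (x./2 == i) = (x == i.*2) || (x == i.*2.+1).
Proof. by apply/eqP/orP => [|[]/eqP]; lia. Qed.

Lemma exp2V_lt (R : realType) (e : R) : 0 < e -> exists k, 2 ^- k < e.
Proof.
move=> e0; exists (Num.bound e^-1).
have e1 : e^-1 < (2 ^ Num.bound e^-1)%:R.
  apply: lt_le_trans (archi_boundP _) _; first by rewrite invr_ge0 ltW.
  by rewrite ler_nat ltnW// ltn_expl.
by rewrite -natrX -[ltRHS]invrK ltf_pV2// posrE ?invr_gt0// ltr0n expn_gt0.
Qed.

Section Dyadic.
Variable R : realType.
Implicit Types (k i : nat) (x : R).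

(** The half-open intervals are disjoint and serve to count masses; the closed [cdyadic] serve where
    closed sets and limits are needed. *)
Definition dyadic k i : set R := `[i%:R / 2 ^+ k, i.+1%:R / 2 ^+ k[.
Definition cdyadic k i : set R := `[i%:R / 2 ^+ k, i.+1%:R / 2 ^+ k].

Lemma dyadicP k i x : dyadic k i x <-> i%:R <= x * 2 ^+ k < i.+1%:R.
Proof.
by rewrite /dyadic/= in_itv/= ler_pdivrMr ?exprn_gt0// ltr_pdivlMr ?exprn_gt0.
Qed.

Lemma cdyadicP k i x : cdyadic k i x <-> i%:R <= x * 2 ^+ k <= i.+1%:R.
Proof.
by rewrite /cdyadic/= in_itv/= ler_pdivrMr ?exprn_gt0// ler_pdivlMr ?exprn_gt0.
Qed.

Lemma dyadic_inj k i i' x : dyadic k i x -> dyadic k i' x -> i = i'.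
Proof.
move=> /dyadicP/andP[a1 a2] /dyadicP/andP[b1 b2].
have := le_lt_trans a1 b2; have := le_lt_trans b1 a2.
by rewrite !ltr_nat; lia.
Qed.

Lemma dyadic_cover k x : 0 <= x < 1 -> exists2 i, (i < 2 ^ k)%N & dyadic k i x.
Proof.
move=> /andP[x0 x1]; exists (Num.truncn (x * 2 ^+ k)).
  rewrite -(ltr_nat R) natrX; apply: (@le_lt_trans _ _ (x * 2 ^+ k)).
    by have /andP[] := truncn_itv (mulr_ge0 x0 (exprn_ge0 k (ler0n R 2))).
  by rewrite gtr_pMl// exprn_gt0.
by apply/dyadicP; apply: truncn_itv; rewrite mulr_ge0// exprn_ge0.
Qed.

Lemma dyadic_split k i : dyadic k i = dyadic k.+1 i.*2 `|` dyadic k.+1 i.*2.+1.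
Proof.
apply/seteqP; split=> x.
  move=> /dyadicP; have [x2|x2] := ltP (x * 2 ^+ k.+1) i.*2.+1%:R.
    move=> h; left; apply/dyadicP; rewrite x2 andbT.
    by move: h; rewrite -mul2n natrM exprS; lra.
  move=> h; right; apply/dyadicP; rewrite x2 /=.
  by move: h; rewrite -doubleS -mul2n natrM exprS; lra.
move=> h; apply/dyadicP; case: h => /dyadicP; rewrite -?doubleS exprS.
  by rewrite -[i.*2.+1%:R]natr1 -!mul2n -natr1 !natrM; lra.
by rewrite -[i.*2.+1%:R]natr1 -!mul2n -natr1 !natrM -natr1; lra.
Qed.

Lemma dyadic_sub_cdyadic k i : dyadic k i `<=` cdyadic k i.
Proof. by move=> x /dyadicP/andP[a b]; apply/cdyadicP; rewrite a ltW. Qed.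

Lemma cdyadic_half k i : cdyadic k.+1 i `<=` cdyadic k i./2.
Proof.
move=> x /cdyadicP; rewrite exprS => h; apply/cdyadicP; move: h.
have := odd_double_half i; move: i./2 => n <-; rewrite -!natr1 natrD -mul2n natrM.
by case: (odd i) => /=; lra.
Qed.

Lemma measurable_dyadic k i : measurable (dyadic k i).
Proof. exact: measurable_itv. Qed.

Lemma measurable_cdyadic k i : measurable (cdyadic k i).
Proof. exact: measurable_itv. Qed.

End Dyadic.
Arguments dyadic : clear implicits.
Arguments cdyadic : clear implicits.

(** * The measure with given masses of dyadic boxes *)

Lemma sum_measure_le d (T : measurableType d) (R : realType)
    (mu : {measure set T -> \bar R}) (K : eqType) (s : seq K) (F : K -> set T)
    (B : set T) : uniq s -> measurable B ->
  (forall p, p \in s -> measurable (F p) /\ F p `<=` B) ->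
  (forall p q x, F p x -> F q x -> p = q) ->
  (\sum_(p <- s) mu (F p) <= mu B)%E.
Proof.
move=> + + + inj; elim: s B => [|p s IH] B; first by rewrite big_nil.
rewrite /= => /andP[ps us] mB FB; rewrite big_cons.
have [mp pB] := FB p (mem_head _ _).
rewrite -(setDUK pB) measureU//; last by rewrite setDIK.
  rewrite leeD2l// IH//; first exact: measurableD.
  move=> q qs; have [|mq qB] := FB q; first by rewrite in_cons qs orbT.
  split=> // x qx; split; first exact: qB.
  by move=> px; move: ps; rewrite (inj p q x)// qs.
exact: measurableD.
Qed.

Lemma measure_le_sum d (T : measurableType d) (R : realType)
    (mu : {measure set T -> \bar R}) (K : eqType) (s : seq K) (F : K -> set T)
    (B : set T) : measurable B -> (forall p, p \in s -> measurable (F p)) ->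
  (forall x, B x -> exists2 p, p \in s & F p x) ->
  (mu B <= \sum_(p <- s) mu (F p))%E.
Proof.
move=> + + cov; elim: s B cov => [|p s IH] B cov mB mF.
  rewrite big_nil (_ : B = set0) ?measure0// -subset0 => x /cov[p].
  by rewrite in_nil.
have mFp : measurable (F p) by apply: mF; rewrite mem_head.
rewrite big_cons (measureDI mu mB mFp) addeC leeD//.
  by apply: le_measure; rewrite ?inE//; exact: measurableI.
apply: IH => [x [Bx Fpx]||q qs]; last by apply: mF; rewrite in_cons qs orbT.
  have [q] := cov x Bx; rewrite in_cons => /orP[/eqP->//|qs Fq].
  by exists q.
exact: measurableD.
Qed.

Section DyadicMeasure.
Variables (R : realType) (m : nat -> nat -> nat -> R).
Hypothesis m_ge0 : forall k i j, 0 <= m k i j.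
Hypothesis m_split : forall k i j, m k i j =
  m k.+1 i.*2 j.*2 + m k.+1 i.*2 j.*2.+1 +
  (m k.+1 i.*2.+1 j.*2 + m k.+1 i.*2.+1 j.*2.+1).

(* The interval [0, m 0 0 0[ is cut into consecutive pieces of lengths m k i j, each
   level refining the previous one; offset k i j is the left end of the piece of
   the box (i, j) of level k. *)
Fixpoint offset (k i j : nat) : R :=
  if k is k'.+1 then
    offset k' i./2 j./2
    + (if odd i then m k i.-1 (j./2).*2 + m k i.-1 (j./2).*2.+1 else 0)
    + (if odd j then m k i j.-1 else 0)
  else 0.

(** At level 0 [offset] is zero for all indices, so the bounds on [i] and [j] keep boxes off the
    grid from overlapping the others. *)
Definition piece (k i j : nat) : set R :=
  [set t | [/\ (i < 2 ^ k)%N, (j < 2 ^ k)%N &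
    offset k i j <= t < offset k i j + m k i j]].

Lemma measurable_piece k i j : measurable (piece k i j).
Proof.
have [i2|i2] := boolP ((i < 2 ^ k) && (j < 2 ^ k))%N; last first.
  rewrite (_ : piece k i j = set0)//; apply/seteqP; split=> // t [a b _].
  by rewrite a b in i2.
rewrite (_ : piece k i j = `[offset k i j, offset k i j + m k i j[%classic)//.
by apply/seteqP; split=> t; rewrite /= in_itv/=; move/andP: i2 => [? ?]; [case|split].
Qed.

Lemma lebesgue_piece k i j : (i < 2 ^ k)%N -> (j < 2 ^ k)%N ->
  lebesgue_measure (piece k i j) = (m k i j)%:E.
Proof.
move=> i2 j2.
rewrite (_ : piece k i j = `[offset k i j, offset k i j + m k i j[%classic).
  rewrite lebesgue_measure_itv/= lte_fin ltrDl -EFinD addrAC subrr add0r.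
  case: ifPn => //; rewrite -leNgt => mle; congr (_%:E); apply/le_anti.
  by rewrite mle m_ge0.
by apply/seteqP; split=> t; rewrite /= in_itv/=; [case|split].
Qed.

(** The four pieces below a box are laid end to end in lexicographic order, and by [m_split] their
    lengths add up to that of the parent. *)
Lemma piece_half k i j : piece k.+1 i j `<=` piece k i./2 j./2.
Proof.
move=> t [i2 j2 /andP[/= t1 t2]]; split; [by move: i2; rewrite expnS; lia|
  by move: j2; rewrite expnS; lia|].
move: t1 t2; rewrite (m_split k i./2 j./2).
have := m_ge0 k.+1 (i./2).*2 (j./2).*2.
have := m_ge0 k.+1 (i./2).*2 (j./2).*2.+1.
have := m_ge0 k.+1 (i./2).*2.+1 (j./2).*2.
have := m_ge0 k.+1 (i./2).*2.+1 (j./2).*2.+1.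
have := odd_double_half i; have := odd_double_half j.
case: (odd i) => /=; case: (odd j) => /=; rewrite ?add1n ?add0n => <- <- /=;
  rewrite ?uphalf_double ?doubleK; lra.
Qed.

(** The parents coincide by induction, and the four pieces below a common parent are disjoint. *)
Lemma piece_inj k i j i' j' t : piece k i j t -> piece k i' j' t ->
  i = i' /\ j = j'.
Proof.
elim: k i j i' j' => [|k IH] i j i' j'.
  by rewrite /piece/= expn0 => -[i0 j0 _] [i0' j0' _]; split; lia.
move=> p p'; have [ii jj] := IH _ _ _ _ (piece_half p) (piece_half p').
case: p => _ _ /=; case: p' => _ _ /=.
have := odd_double_half i; have := odd_double_half j.
have := odd_double_half i'; have := odd_double_half j'.
rewrite -ii -jj.
have := m_ge0 k.+1 (i./2).*2 (j./2).*2.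
have := m_ge0 k.+1 (i./2).*2 (j./2).*2.+1.
have := m_ge0 k.+1 (i./2).*2.+1 (j./2).*2.
have := m_ge0 k.+1 (i./2).*2.+1 (j./2).*2.+1.
move: (i./2) (j./2) => a b {ii jj}.
case: (odd i) => /=; case: (odd j) => /=; case: (odd i') => /=; case: (odd j') => /=;
  rewrite ?add1n ?add0n => ? ? ? ? <- <- <- <- /= ??; split=> //; exfalso; lra.
Qed.

Lemma piece_cover k t : 0 <= t < m 0 0 0 -> exists i j, piece k i j t.
Proof.
move=> t0; elim: k => [|k [i [j [i2 j2 tij]]]].
  by exists 0%N, 0%N; split; rewrite ?expn0//= add0r.
have := tij; rewrite (m_split k i j) => tij'.
have [h1 h2 h3 h4] : [/\ (i.*2 < 2 ^ k.+1)%N, (j.*2 < 2 ^ k.+1)%N,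
    (i.*2.+1 < 2 ^ k.+1)%N & (j.*2.+1 < 2 ^ k.+1)%N].
  by rewrite expnS; split; lia.
have [t1|t1] := ltP t (offset k i j + m k.+1 i.*2 j.*2).
  by exists i.*2, j.*2; split=> //=; rewrite !odd_double !doubleK; lra.
have [t2|t2] := ltP t (offset k i j + m k.+1 i.*2 j.*2 + m k.+1 i.*2 j.*2.+1).
  exists i.*2, j.*2.+1; split=> //=.
  by rewrite !odd_double/= !doubleK uphalf_double; lra.
have [t3|t3] := ltP t (offset k i j + (m k.+1 i.*2 j.*2 + m k.+1 i.*2 j.*2.+1) +
    m k.+1 i.*2.+1 j.*2).
  exists i.*2.+1, j.*2; split=> //=.
  by rewrite !odd_double/= !doubleK uphalf_double; lra.
exists i.*2.+1, j.*2.+1; split=> //=.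
by rewrite !odd_double/= !uphalf_double; lra.
Qed.

Lemma piece_sub k i j t : piece k i j t -> 0 <= t < m 0 0 0.
Proof.
elim: k i j => [|k IH] i j; last by move/piece_half/IH.
case=> /=; rewrite expn0 add0r => i0 j0.
by have [-> ->] : i = 0%N /\ j = 0%N by split; lia.
Qed.

Section Coordinate.
Variable c : nat -> nat -> nat.
Hypothesis c_half : forall i j, (c i j)./2 = c i./2 j./2.

(** On a piece this is the left end of the dyadic interval numbered [c i j]. Taking either index for
    [c] gives both coordinates by one construction; [c_half] says that the intervals nest. *)
Definition approx k (t : R) : R :=
  \sum_(p : 'I_(2 ^ k) * 'I_(2 ^ k))
    (c p.1 p.2)%:R / 2 ^+ k * \1_(piece k p.1 p.2) t.

Lemma measurable_approx k : measurable_fun setT (approx k).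
Proof.
apply: measurable_sum => p; apply: measurable_funM; first exact: measurable_cst.
by apply: measurable_indic; exact: measurable_piece.
Qed.

Lemma approxE k i j t : piece k i j t -> approx k t = (c i j)%:R / 2 ^+ k.
Proof.
move=> pt; have [i2 j2 _] := pt.
rewrite /approx (bigD1 (Ordinal i2, Ordinal j2))//= indicE mem_set// mulr1.
rewrite big1 ?addr0// => -[i' j'] /= ij'; rewrite indicE memNset ?mulr0//= => pt'.
have [ii jj] := piece_inj pt pt'.
by move: ij' => /eqP; apply; congr (_, _); apply/val_inj.
Qed.

Lemma approx_out k t : ~~ (0 <= t < m 0 0 0) -> approx k t = 0.
Proof.
move=> t0; rewrite /approx big1// => p _; rewrite indicE memNset ?mulr0//.
by move=> /piece_sub; exact/negP.
Qed.

(** Passing to a child moves the left end no lower and the right end no higher; off the pieces both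
    approximations vanish. *)
Lemma approx_step k t :
  approx k t <= approx k.+1 t /\
  approx k.+1 t + 2 ^- k.+1 <= approx k t + 2 ^- k.
Proof.
have k2 : (2 ^+ k : R) != 0 by rewrite expf_neq0.
have kE : (2 ^- k : R) = 2 ^- k.+1 + 2 ^- k.+1 by rewrite exprS; field.
have k0 : (0 : R) < 2 ^- k.+1 by rewrite invr_gt0 exprn_gt0.
have [t0|t0] := boolP (0 <= t < m 0 0 0); last by rewrite !approx_out//; lra.
have [i [j pt]] := piece_cover k.+1 t0.
rewrite (approxE pt) (approxE (piece_half pt)) -c_half kE.
have := odd_double_half (c i j); move: (c i j)./2 => n <-.
rewrite natrD -addnn natrD; move: (n%:R : R) => x.
by case: (odd _) => /=; set e := 2 ^- k.+1 in k0 *; nra.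
Qed.

Definition coord t : R := limn (approx ^~ t).

Lemma approx_bounds t k n : (k <= n)%N ->
  approx k t <= approx n t <= approx k t + 2 ^- k.
Proof.
move=> kn; apply/andP; split.
  move: k n kn; apply/nondecreasing_seqP => k.
  by case: (approx_step k t).
have n0 : (0 : R) < 2 ^- n by rewrite invr_gt0 exprn_gt0.
apply: le_trans (_ : approx n t + 2 ^- n <= _); first lra.
move: k n kn {n0}; apply/(nonincreasing_seqP (fun n => approx n t + 2 ^- n)) => k.
by case: (approx_step k t).
Qed.

Lemma cvg_approx t : approx ^~ t @ \oo --> coord t.
Proof.
apply: nondecreasing_is_cvgn => [k n /(approx_bounds t)/andP[]//|].
by exists (approx 0 t + 2 ^- 0) => _ [n _ <-]; case/andP: (approx_bounds t (leq0n n)).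
Qed.

Lemma measurable_coord : measurable_fun setT coord.
Proof.
apply: (measurable_fun_cvg measurable_approx) => t _; exact: cvg_approx.
Qed.

(** The nested intervals trap the limit, which may be their right end; hence the closed interval. *)
Lemma coord_piece k i j t : piece k i j t ->
  (c i j)%:R / 2 ^+ k <= coord t <= (c i j).+1%:R / 2 ^+ k.
Proof.
move=> pt; rewrite -[(c i j).+1%:R]natr1 mulrDl mul1r -(approxE pt); apply/andP; split.
  apply: limr_ge; first by apply: cvgP; exact: cvg_approx.
  by exists k => // n /= /(approx_bounds t)/andP[].
apply: limr_le; first by apply: cvgP; exact: cvg_approx.
by exists k => // n /= /(approx_bounds t)/andP[].
Qed.

End Coordinate.

(** [rho] is the image of Lebesgue measure under the pair of coordinate maps. Each piece lands in
    its closed box. Only lower bounds are claimed, since closed boxes share sides, where mass may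
    sit. *)
Theorem dyadic_measure : exists rho : {measure set (R * R)%type -> \bar R},
  rho setT = (m 0 0 0)%:E /\
  forall k (P : nat -> nat -> bool) B, measurable B ->
    (forall i j, (i < 2 ^ k)%N -> (j < 2 ^ k)%N -> P i j ->
       cdyadic R k i `*` cdyadic R k j `<=` B) ->
    ((\sum_(p : 'I_(2 ^ k) * 'I_(2 ^ k) | P p.1 p.2) m k p.1 p.2)%:E <= rho B)%E.
Proof.
pose cX (i j : nat) := i; pose cY (i j : nat) := j.
pose phi t : R * R := (coord cX t, coord cY t).
have mphi : measurable_fun setT phi.
  by apply: measurable_fun_pair; exact: measurable_coord.
pose D : set R := `[0, m 0 0 0[%classic.
have mD : measurable D by exact: measurable_itv.
pose leb := mrestr (@lebesgue_measure R) mD.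
unshelve eexists (pushforward leb phi : {measure set _ -> \bar _}); first exact: mphi.
split.
  rewrite /= /pushforward preimage_setT /leb /mrestr setTI /D.
  rewrite lebesgue_measure_itv/= lte_fin sube0; case: ltP => //= m0.
  by congr (_%:E); apply/le_anti; rewrite m0 m_ge0.
move=> k P B mB PB; rewrite /= /pushforward.
rewrite -sumEFin -big_filter.
rewrite (eq_big_seq (fun p : 'I_(2 ^ k) * 'I_(2 ^ k) => leb (piece k p.1 p.2))); last first.
  move=> p _; rewrite /leb /mrestr setIidl ?lebesgue_piece//.
  by move=> t /piece_sub; rewrite /D/= in_itv.
apply: sum_measure_le => //.
- by rewrite filter_uniq// index_enum_uniq.
- by rewrite -[X in measurable X]setTI; exact: mphi.
- move=> [i j]; rewrite mem_filter/= => /andP[Pij _].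
  split; first exact: measurable_piece.
  move=> t pt; apply: (PB i j) => //.
  have := coord_piece (c := cX) (fun _ _ => erefl) pt.
  have := coord_piece (c := cY) (fun _ _ => erefl) pt.
  by move=> ? ?; split; rewrite /cdyadic/= in_itv.
- move=> [i j] [i' j'] t /= pt pt'; have [ii jj] := piece_inj pt pt'.
  by congr (_, _); apply/val_inj.
Qed.

End DyadicMeasure.

(** * Limits of dyadic transport plans *)

(** The segment is compact, so the image ultrafilter has a cluster point, and an ultrafilter
    converges to its cluster points. *)
Lemma ultra_cvg_itv (R : realType) (T : Type) (G : set_system T)
    (u : T -> R) (a b : R) : UltraFilter G -> (forall n, a <= u n <= b) ->
  cvg (u @ G).
Proof.
move=> GU uab.
have abG : (u @ G) `[a, b]%classic.
  by rewrite nbhs_filterE /=; apply: filterE => n; rewrite /= in_itv/=.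
have [p [_ pG]] := @segment_compact R a b (u @ G) _ abG.
apply/cvg_ex; exists p => B pB.
have [//|GB] := in_ultra_setVsetC (u @^-1` B) GU.
by have [x []] := pG (~` B) B GB pB.
Qed.

Section DyadicLimit.
Variables (R : realType) (a b : nat -> nat -> R) (e : nat -> nat -> nat -> Prop).
Variable w : nat -> nat -> nat -> R.
Hypothesis a_split : forall k i, a k i = a k.+1 i.*2 + a k.+1 i.*2.+1.
Hypothesis b_split : forall k i, b k i = b k.+1 i.*2 + b k.+1 i.*2.+1.
Hypothesis e_half : forall k i j, e k.+1 i j -> e k i./2 j./2.
Hypothesis w_ge0 : forall n i j, 0 <= w n i j.
Hypothesis w_e : forall n i j, 0 < w n i j -> e n i j.
Hypothesis w_row : forall n i, (i < 2 ^ n)%N -> \sum_(j < 2 ^ n) w n i j = a n i.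
Hypothesis w_col : forall n j, (j < 2 ^ n)%N -> \sum_(i < 2 ^ n) w n i j = b n j.

(** [x %/ 2 ^ d] is the ancestor of [x] that lies [d] levels higher; additivity over two children is
    iterated from the top. *)
Lemma sum_descendants (c : nat -> nat -> R) k d i :
  (forall k i, c k i = c k.+1 i.*2 + c k.+1 i.*2.+1) -> (i < 2 ^ k)%N ->
  \sum_(x < 2 ^ (k + d) | (x %/ 2 ^ d)%N == i) c (k + d)%N x = c k i.
Proof.
move=> c_split; elim: d => [|d IH] in k i *.
  move=> ik; rewrite addn0.
  under eq_bigl do rewrite expn0 divn1.
  by rewrite (big_pred1 (Ordinal ik)).
move=> ik; rewrite c_split -!addSnnS -!IH; [|by rewrite expnS; lia..].
rewrite [X in _ = X + _]big_mkcond [X in _ = _ + X]big_mkcond -big_split/=.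
rewrite big_mkcond; apply: eq_bigr => x _; rewrite div_exp2S half_eq.
by case: eqP => [->|]; case: eqP => //=; rewrite ?addr0 ?add0r//; lia.
Qed.

(* The mass that the plan of level n gives to the box (i, j) of level k <= n. *)
Definition coarse n k i j : R :=
  \sum_(p : 'I_(2 ^ n) * 'I_(2 ^ n) |
    ((p.1 %/ 2 ^ (n - k))%N == i) && ((p.2 %/ 2 ^ (n - k))%N == j)) w n p.1 p.2.

(** Each box of level [n] below the box [(i, j)] is below exactly one of its four children; [k < n]
    ensures that level [n] reaches the children. *)
Lemma coarse_split n k i j : (k < n)%N -> coarse n k i j =
  coarse n k.+1 i.*2 j.*2 + coarse n k.+1 i.*2 j.*2.+1 +
  (coarse n k.+1 i.*2.+1 j.*2 + coarse n k.+1 i.*2.+1 j.*2.+1).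
Proof.
move=> kn; rewrite /coarse -(subnSK kn) [LHS]big_mkcond.
rewrite [X in _ = X + _ + _]big_mkcond [X in _ = _ + X + _]big_mkcond.
rewrite [X in _ = _ + (X + _)]big_mkcond [X in _ = _ + (_ + X)]big_mkcond.
rewrite -!big_split/=; apply: eq_bigr => p _.
rewrite !div_exp2S !half_eq.
move: (p.1 %/ _)%N (p.2 %/ _)%N => x y.
have [->|] := eqVneq x i.*2; have [->|] := eqVneq y j.*2;
  rewrite ?[i.*2 == _.+1]ltn_eqF ?[j.*2 == _.+1]ltn_eqF//= ?andbF ?andbT ?addr0 ?add0r//;
  case: (_ == _) => //=; rewrite ?andbF ?andbT ?addr0 ?add0r//;
  case: (_ == _) => //=; rewrite ?andbF ?andbT ?addr0 ?add0r//.
Qed.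

Lemma coarse_row n k i : (k <= n)%N -> (i < 2 ^ k)%N ->
  \sum_(j < 2 ^ k) coarse n k i j = a k i.
Proof.
move=> kn ik; rewrite /coarse.
rewrite (exchange_big_dep (fun p : 'I_(2 ^ n) * 'I_(2 ^ n) =>
  (p.1 %/ 2 ^ (n - k))%N == i))/=; last by move=> j p _ /andP[].
rewrite -(sum_descendants (n - k) a_split ik) subnKC//.
under [RHS]eq_bigr do rewrite -w_row//.
rewrite [RHS]pair_big_dep/=; apply: eq_big => [p|p]; first by rewrite andbT.
move=> /eqP pi; rewrite pi eqxx /=.
have p2 : (p.2 %/ 2 ^ (n - k) < 2 ^ k)%N.
  by rewrite ltn_divLR ?expn_gt0// -expnD subnKC.
by rewrite (big_pred1 (Ordinal p2))// => j; rewrite eq_sym.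
Qed.

Lemma coarse_col n k j : (k <= n)%N -> (j < 2 ^ k)%N ->
  \sum_(i < 2 ^ k) coarse n k i j = b k j.
Proof.
move=> kn jk; rewrite /coarse.
rewrite (exchange_big_dep (fun p : 'I_(2 ^ n) * 'I_(2 ^ n) =>
  (p.2 %/ 2 ^ (n - k))%N == j))/=; last by move=> i p _ /andP[].
rewrite -(sum_descendants (n - k) b_split jk) subnKC//.
under [RHS]eq_bigr do rewrite -w_col//.
rewrite [RHS]exchange_big/= [RHS]pair_big_dep/=; apply: eq_big => [p|p]//.
move=> /eqP pj; rewrite pj eqxx.
have p1 : (p.1 %/ 2 ^ (n - k) < 2 ^ k)%N.
  by rewrite ltn_divLR ?expn_gt0// -expnD subnKC.
by rewrite (big_pred1 (Ordinal p1))// => i; rewrite andbT eq_sym.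
Qed.

Lemma coarse_ge0 n k i j : 0 <= coarse n k i j.
Proof. by apply: sumr_ge0. Qed.

(** A bound uniform in [n], which puts the masses in a compact segment. *)
Lemma coarse_le n k i j : coarse n k i j <= a 0 0.
Proof.
rewrite -(@coarse_row n 0 0)// big_ord1 /coarse [leLHS]big_mkcond [leRHS]big_mkcond.
apply: ler_sum => p _.
by rewrite subn0 (divn_small (ltn_ord p.1)) (divn_small (ltn_ord p.2))/=; case: ifP.
Qed.

(** A positive sum has a positive term, at a box in the relation [e]; [e_half] carries the relation
    up to the ancestor. *)
Lemma coarse_e n k i j : (k <= n)%N -> 0 < coarse n k i j -> e k i j.
Proof.
move=> kn c0.
have [[x y] /= /andP[/andP[/eqP <- /eqP <-]] w0] : exists p : 'I_(2 ^ n) * 'I_(2 ^ n),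
    (((p.1 %/ 2 ^ (n - k))%N == i) && ((p.2 %/ 2 ^ (n - k))%N == j)) && (0 < w n p.1 p.2).
  apply/not_existsP => H; move: c0; rewrite /coarse big1 ?ltxx// => p pij.
  have := H p; rewrite pij/= => /negP; rewrite -leNgt => w0.
  by apply/le_anti; rewrite w0 w_ge0.
move: w0 => /w_e; rewrite -{1}(subnKC kn).
move: (nat_of_ord x) (nat_of_ord y); elim: (n - k)%N => [|d IH] {}x {}y.
  by rewrite addn0 expn0 !divn1.
by rewrite addnS expnS !divnMA !divn2 => /e_half/IH.
Qed.

Theorem dyadic_limit : exists m : nat -> nat -> nat -> R,
  [/\ forall k i j, 0 <= m k i j,
      forall k i j, m k i j = m k.+1 i.*2 j.*2 + m k.+1 i.*2 j.*2.+1 +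
        (m k.+1 i.*2.+1 j.*2 + m k.+1 i.*2.+1 j.*2.+1),
      forall k i j, 0 < m k i j -> e k i j,
      forall k i, (i < 2 ^ k)%N -> \sum_(j < 2 ^ k) m k i j = a k i &
      forall k j, (j < 2 ^ k)%N -> \sum_(i < 2 ^ k) m k i j = b k j].
Proof.
(* One ultrafilter refining the eventual filter makes the masses of all boxes converge at once,
   without a diagonal extraction. *)
have [G [GU Goo]] := ultraFilterLemma (@eventually_filter).
pose m k i j := lim (coarse n k i j @[n --> G]).
have cvg_m k i j : coarse n k i j @[n --> G] --> m k i j.
  apply: (@ultra_cvg_itv R _ _ _ 0 (a 0 0) GU) => n.
  by rewrite coarse_ge0 coarse_le.
have ev k : \forall n \near G, (k <= n)%N by apply: Goo; exact: nbhs_infty_ge.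
exists m; split.
- move=> k i j; apply: (cvgr_to_ge (cvg_m k i j)).
  by apply: filterE => n; exact: coarse_ge0.
- move=> k i j; apply: (cvg_unique _ (cvg_m k i j)) => //.
  apply: cvg_trans; last first.
    exact: (cvgD (cvgD (cvg_m k.+1 i.*2 j.*2) (cvg_m k.+1 i.*2 j.*2.+1))
      (cvgD (cvg_m k.+1 i.*2.+1 j.*2) (cvg_m k.+1 i.*2.+1 j.*2.+1))).
  apply: near_eq_cvg; apply: filterS (ev k.+1) => n kn /=.
  by rewrite coarse_split.
(* Outside [e] the coarse masses are nonpositive once [k <= n], hence so is their limit. *)
- move=> k i j mk; apply: contrapT => nek.
  suff : m k i j <= 0 by rewrite leNgt mk.
  apply: (cvgr_to_le (cvg_m k i j)); apply: filterS (ev k) => n kn.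
  by rewrite leNgt; apply/negP => /(coarse_e kn).
- move=> k i ik.
  have H : \sum_(j < 2 ^ k) coarse n k i j @[n --> G] --> \sum_(j < 2 ^ k) m k i j.
    by apply: cvg_big; [exact: add_continuous|move=> j _; exact: cvg_m].
  apply: (cvg_unique _ H) => //; apply: cvg_near_cst; apply: filterS (ev k) => n kn.
  exact: coarse_row.
- move=> k j jk.
  have H : \sum_(i < 2 ^ k) coarse n k i j @[n --> G] --> \sum_(i < 2 ^ k) m k i j.
    by apply: cvg_big; [exact: add_continuous|move=> i _; exact: cvg_m].
  apply: (cvg_unique _ H) => //; apply: cvg_near_cst; apply: filterS (ev k) => n kn.
  exact: coarse_col.
Qed.

End DyadicLimit.

(** * Comparing measures on dyadic intervals *)

Section BoundedByLambda.
Variables (R : realType) (alpha : {measure set R -> \bar R}).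
Hypothesis alpha_le : forall A, measurable A -> (alpha A <= @lambda R A)%E.

Lemma lambda_le_lebesgue (A : set R) : measurable A -> (@lambda R A <= lebesgue_measure A)%E.
Proof.
by move=> mA; apply: le_measure; rewrite ?inE//; exact: measurableI.
Qed.

Lemma lambda_setT : @lambda R setT = 1%E.
Proof. by rewrite /lambda /mrestr setTI lebesgue_measure_itv/= lte01 sube0. Qed.

Lemma le_lambda_fin A : measurable A -> alpha A \is a fin_num.
Proof.
move=> mA; rewrite ge0_fin_numE//; apply: le_lt_trans (alpha_le mA) _.
apply: (@le_lt_trans _ _ (@lambda R setT)); last by rewrite lambda_setT ltry.
by apply: le_measure; rewrite ?inE.
Qed.

Lemma le_lambda_null A : measurable A -> lebesgue_measure A = 0%E -> alpha A = 0%E.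
Proof.
move=> mA A0; apply/eqP; rewrite -measure_le0 -A0.
exact: le_trans (alpha_le mA) (lambda_le_lebesgue mA).
Qed.

Lemma le_lambda_out : alpha (~` `[0, 1[) = 0%E.
Proof.
have mI : measurable (~` `[0, 1[ : set R) by exact: measurableC.
apply/eqP; rewrite -measure_le0; apply: le_trans (alpha_le mI) _.
rewrite /lambda /mrestr -(lebesgue_measure_set1 (1 : R)).
apply: le_measure; rewrite ?inE//; first exact: measurableI.
move=> x [] /=; rewrite !in_itv/= => /negP; rewrite negb_and -ltNge -leNgt.
by move=> /orP[?|?] /andP[? ?]; apply/le_anti; lra.
Qed.

Definition dyadic_mass k i : R := fine (alpha (dyadic R k i)).

Lemma dyadic_massE k i : (dyadic_mass k i)%:E = alpha (dyadic R k i).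
Proof. by rewrite fineK// le_lambda_fin//; exact: measurable_dyadic. Qed.

Lemma dyadic_mass_ge0 k i : 0 <= dyadic_mass k i.
Proof. by rewrite fine_ge0. Qed.

Lemma dyadic_mass_split k i :
  dyadic_mass k i = dyadic_mass k.+1 i.*2 + dyadic_mass k.+1 i.*2.+1.
Proof.
apply: EFin_inj; rewrite EFinD !dyadic_massE dyadic_split measureU//;
  [exact: measurable_dyadic|exact: measurable_dyadic|].
by rewrite -subset0 => x [/dyadic_inj h /h]; lia.
Qed.

(** Domination by Lebesgue measure makes the right end a null set. *)
Lemma cdyadic_massE k i : alpha (cdyadic R k i) = (dyadic_mass k i)%:E.
Proof.
rewrite dyadic_massE; apply/eqP; rewrite eq_le; apply/andP; split; last first.
  apply: le_measure; rewrite ?inE; [exact: measurable_dyadic|exact: measurable_cdyadic|].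
  exact: dyadic_sub_cdyadic.
have <- : (alpha (dyadic R k i) + alpha ([set i.+1%:R / 2 ^+ k]%R : set R) =
    alpha (dyadic R k i))%E.
  by rewrite (le_lambda_null (measurable_set1 _) (lebesgue_measure_set1 _))// adde0.
apply: le_trans (measureU2 _ (measurable_dyadic _ _) (measurable_set1 _)).
apply: le_measure; rewrite ?inE; [exact: measurable_cdyadic| |].
  by apply: measurableU; [exact: measurable_dyadic|exact: measurable_set1].
move=> x; rewrite /cdyadic /dyadic/= !in_itv/= => /andP[-> /=].
by rewrite le_eqVlt => /orP[/eqP|]; [right|left].
Qed.

End BoundedByLambda.

Section Marginal.
Variables (R : realType) (alpha nu : {measure set R -> \bar R}).
Hypothesis alpha_le : forall A, measurable A -> (alpha A <= @lambda R A)%E.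

(** [C] absorbs the boundary of [B]; the rest of [B] is covered by the dyadic intervals it meets, up
    to the null set outside the half-open unit interval. *)
Lemma le_dyadic_sum k (P : nat -> bool) (B C : set R) :
  measurable B -> measurable C ->
  (forall x i, B x -> ~ C x -> dyadic R k i x -> P i) ->
  (alpha B <= (\sum_(i < 2 ^ k | P i) dyadic_mass alpha k i)%:E + lebesgue_measure C)%E.
Proof.
move=> mB mC BCP; have mI : measurable (`[0, 1[ : set R) by [].
have mD : measurable (C `|` ~` `[0, 1[) by apply: measurableU => //; exact: measurableC.
rewrite (measureDI alpha mB mD) leeD//.
  rewrite -sumEFin -big_filter.
  rewrite (eq_big_seq (fun i : 'I_(2 ^ k) => alpha (dyadic R k i))); last first.
    by move=> i _; rewrite dyadic_massE.
  apply: measure_le_sum => [|i _|x [Bx] /not_orP[nCx /contrapT x01]].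
  - exact: measurableD.
  - exact: measurable_dyadic.
  move: x01; rewrite /= in_itv/= => x01; have [i i2 kix] := dyadic_cover k x01.
  by exists (Ordinal i2) => //; rewrite mem_filter /= mem_index_enum andbT (BCP x).
apply: (@le_trans _ _ (alpha (C `|` ~` `[0, 1[))).
  by apply: le_measure; rewrite ?inE//; exact: measurableI.
apply: le_trans (measureU2 _ mC (measurableC mI)) _.
rewrite [X in (_ + X)%E]le_lambda_out// adde0.
by apply: le_trans (alpha_le mC) _; exact: lambda_le_lebesgue.
Qed.

Lemma le_of_dyadic_sums (B : set R) (C : nat -> set R) (P : nat -> nat -> bool) :
  measurable B -> (forall k, measurable (C k)) ->
  (forall k, (lebesgue_measure (C k) <= (2 ^- k)%:E)%E) ->
  (forall k x i, B x -> ~ C k x -> dyadic R k i x -> P k i) ->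
  (forall k, ((\sum_(i < 2 ^ k | P k i) dyadic_mass alpha k i)%:E <= nu B)%E) ->
  (alpha B <= nu B)%E.
Proof.
move=> mB mC C2 BCP sB; apply/lee_addgt0Pr => e e0.
have [k ke] := exp2V_lt e0.
apply: le_trans (le_dyadic_sum mB (mC k) (BCP k)) _; rewrite leeD//.
by apply: le_trans (C2 k) _; rewrite lee_fin ltW.
Qed.

Hypothesis nu_total : nu setT = alpha setT.
Hypothesis nu_ge : forall k (P : nat -> bool) (B : set R), measurable B ->
  (forall i, (i < 2 ^ k)%N -> P i -> cdyadic R k i `<=` B) ->
  ((\sum_(i < 2 ^ k | P i) dyadic_mass alpha k i)%:E <= nu B)%E.

(** Lower bounds on rays in both directions and equal total masses force equality on left rays,
    which generate the Borel sets and are closed under intersection. *)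
Lemma eq_of_dyadic_sums A : measurable A -> nu A = alpha A.
Proof.
have band (x : R) k : (lebesgue_measure (`[x, (x + 2 ^- k)%R[ : set R) <= (2 ^- k)%:E)%E.
  rewrite lebesgue_measure_itv/=; case: ifP => _.
    by rewrite -EFinD addrAC subrr add0r.
  by rewrite lee_fin invr_ge0 exprn_ge0.
have lt_x (x : R) : (alpha `]-oo, x[%classic <= nu `]-oo, x[%classic)%E.
  (* A dyadic interval with a point left of [x - 2 ^- k] ends before [x]. The strict inequality
     keeps its closure inside the open ray. *)
  apply: (@le_of_dyadic_sums _ (fun k => `[x - 2 ^- k, x[%classic)
      (fun k i => i.+1%:R < x * 2 ^+ k)) => //.
  - by move=> k; have := band (x - 2 ^- k) k; rewrite subrK.
  - move=> k y i; rewrite /= !in_itv/= => yx /negP; rewrite yx andbT -ltNge => yk.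
    move=> /dyadicP/andP[iy _].
    have k0 : (0 : R) < 2 ^+ k by rewrite exprn_gt0.
    have : y * 2 ^+ k < (x - 2 ^- k) * 2 ^+ k by rewrite ltr_pM2r.
    by rewrite mulrBl mulVf ?gt_eqF// -natr1; lra.
  - move=> k; apply: (nu_ge (P := fun i => i.+1%:R < x * 2 ^+ k)) => // i _ ix y.
    move=> /cdyadicP/andP[_ yi].
    have k0 : (0 : R) < 2 ^+ k by rewrite exprn_gt0.
    by rewrite /= in_itv/= -(ltr_pM2r k0); lra.
have ge_x (x : R) : (alpha `[x, +oo[%classic <= nu `[x, +oo[%classic)%E.
  apply: (@le_of_dyadic_sums _ (fun k => `[x, x + 2 ^- k[%classic)
      (fun k i => x * 2 ^+ k <= i%:R)) => //.
  - move=> k y i; rewrite /= !in_itv/= andbT => xy /negP; rewrite xy/= -leNgt => yk.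
    move=> /dyadicP/andP[_ iy].
    have k0 : (0 : R) < 2 ^+ k by rewrite exprn_gt0.
    have : (x + 2 ^- k) * 2 ^+ k <= y * 2 ^+ k by rewrite ler_pM2r.
    by move: iy; rewrite mulrDl mulVf ?gt_eqF// -natr1; lra.
  - move=> k; apply: (nu_ge (P := fun i => x * 2 ^+ k <= i%:R)) => // i _ ix y.
    move=> /cdyadicP/andP[yi _].
    have k0 : (0 : R) < 2 ^+ k by rewrite exprn_gt0.
    by rewrite /= in_itv/= andbT -(ler_pM2r k0); lra.
have split_x (mu : {measure set R -> \bar R}) (x : R) :
    mu setT = (mu `]-oo, x[%classic + mu `[x, +oo[%classic)%E.
  rewrite -measureU//.
    by congr (mu _); rewrite -setCitvl setUv.
  by rewrite -setCitvl setICr.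
have fina := le_lambda_fin alpha_le.
have eq_x (x : R) : nu `]-oo, x[%classic = alpha `]-oo, x[%classic.
  apply/eqP; rewrite eq_le lt_x andbT.
  rewrite -(@leeD2rE _ (alpha `[x, +oo[%classic))//; last exact: fina.
  by rewrite -split_x -nu_total (split_x nu x) leeD2l.
move=> mA.
apply: (measure_unique (@RGenInftyO.G R) (fun n : nat => `]-oo, n%:R[%classic)) => //.
- exact: RGenInftyO.measurableE.
- move=> _ _ [x ->] [y ->]; exists (Num.min x y); apply/seteqP; split=> z /=;
    by rewrite !in_itv/= lt_min => /andP.
- by move=> n; exists n%:R.
- apply/seteqP; split=> // x _; exists (Num.bound `|x|) => //=; rewrite in_itv/=.
  by apply: le_lt_trans (ler_norm x) _; exact: archi_boundP.
- by move=> _ [x ->]; exact: eq_x.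
- by move=> n; rewrite eq_x ltey_eq fina.
Qed.

End Marginal.

(** * Measurability of boxes and neighborhoods *)

Section RationalBoxes.
Variable R : realType.

(** A countable base of the plane; numbers that code no quadruple give the empty set. *)
Definition rat_box (n : nat) : set (R * R) :=
  if unpickle n is Some (a, b, c, d) then
    `](ratr a : R), ratr b[ `*` `](ratr c : R), ratr d[ else set0.

Lemma measurable_rat_box n : measurable (rat_box n).
Proof.
rewrite /rat_box; case: unpickle => [[[[a b] c] d]|//].
by apply: measurableX; exact: measurable_itv.
Qed.

Lemma rat_box_basis (p : R * R) V : nbhs p V -> exists2 n, rat_box n p & rat_box n `<=` V.
Proof.
move=> /nbhs_ballP[e /= e0 eV].
have [a /[!in_itv]/= /andP[a1 a2]] := @rat_in_itvoo R (p.1 - e) p.1 ltac:(lra).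
have [b /[!in_itv]/= /andP[b1 b2]] := @rat_in_itvoo R p.1 (p.1 + e) ltac:(lra).
have [c /[!in_itv]/= /andP[c1 c2]] := @rat_in_itvoo R (p.2 - e) p.2 ltac:(lra).
have [d /[!in_itv]/= /andP[d1 d2]] := @rat_in_itvoo R p.2 (p.2 + e) ltac:(lra).
exists (pickle (a, b, c, d)); rewrite /rat_box pickleK.
  by split; rewrite /= in_itv/=; apply/andP.
move=> q [] /=; rewrite !in_itv/= => /andP[? ?] /andP[? ?]; apply: eV.
by split; rewrite /ball/= ltr_norml; lra.
Qed.

Lemma open_bigcup_rat_box (A : set (R * R)) : open A ->
  A = \bigcup_(n in [set n | rat_box n `<=` A]) rat_box n.
Proof.
move=> oA; apply/seteqP; split=> [p Ap|p [n nA]]; last exact: nA.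
by have [|n np nA] := @rat_box_basis p A; [exact: open_nbhs_nbhs|exists n].
Qed.

(** The product sigma-algebra comes from rectangles, and the countable base writes an open set as a
    countable union of them. *)
Lemma open_measurable_prod (A : set (R * R)) : open A -> measurable A.
Proof.
move=> /open_bigcup_rat_box ->; apply: bigcup_measurable => n _.
exact: measurable_rat_box.
Qed.

Lemma closed_measurable_prod (A : set (R * R)) : closed A -> measurable A.
Proof. by rewrite -openC => /open_measurable_prod/measurableC; rewrite setCK. Qed.

End RationalBoxes.
Arguments rat_box : clear implicits.

Section Neighborhood.
Variables (R : realType) (S : set (R * R)).
Hypotheses (hS : closed S) (hSsq : S `<=` @unit_square R).

(** The neighborhood is the projection of a closed part of the compact square. *)
Lemma closed_nbhd U : closed U -> closed (nbhd S U).
Proof.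
move=> cU; apply: compact_closed; first exact: Rhausdorff.
have -> : nbhd S U = snd @` (S `&` (fst @^-1` U)).
  apply/seteqP; split=> [y [x Ux Sxy]|_ [[x y] [Sxy Ux] <-]]; last by exists x.
  by exists (x, y).
apply: continuous_compact; first by apply: continuous_subspaceT => x; exact: cvg_snd.
apply: compact_closedI.
  apply: subclosed_compact hSsq => //; apply: compact_setX; exact: segment_compact.
by apply: preimage_closed => // x _; exact: cvg_fst.
Qed.

End Neighborhood.

(** * Strassen's theorem on the square *)

Section Strassen.
Variables (R : realType) (S : set (R * R)) (alpha beta : {measure set R -> \bar R}).
Hypotheses (hS : closed S) (hSsq : S `<=` @unit_square R).
Hypothesis alpha_le : forall A, measurable A -> (alpha A <= @lambda R A)%E.
Hypothesis beta_le : forall A, measurable A -> (beta A <= @lambda R A)%E.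
Hypothesis alpha_beta : alpha setT = beta setT.
Hypothesis alpha_nbhd : forall U, closed U -> U `<=` @unit_itv R ->
  (alpha U <= beta (nbhd S U))%E.

Local Notation a := (dyadic_mass alpha).
Local Notation b := (dyadic_mass beta).

Definition meets k i j : Prop := S `&` (cdyadic R k i `*` cdyadic R k j) !=set0.

Lemma meets_half k i j : meets k.+1 i j -> meets k i./2 j./2.
Proof.
move=> [p [Sp [p1 p2]]]; exists p; split=> //.
by split; exact: cdyadic_half.
Qed.

Lemma cdyadic_sub_unit k i : (i < 2 ^ k)%N -> cdyadic R k i `<=` @unit_itv R.
Proof.
move=> ik x /cdyadicP/andP[x1 x2]; have k0 : (0 : R) < 2 ^+ k by rewrite exprn_gt0.
rewrite /unit_itv/= in_itv/= -(ler_pM2r k0) -[X in _ && X](ler_pM2r k0) mul0r mul1r.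
rewrite (le_trans _ x1)//= (le_trans x2)//.
by rewrite -natrX ler_nat.
Qed.

Lemma cdyadic_cover k x : @unit_itv R x -> exists2 i, (i < 2 ^ k)%N & cdyadic R k i x.
Proof.
rewrite /unit_itv/= in_itv/= => /andP[x0]; rewrite le_eqVlt => /orP[/eqP->|x1].
  exists (2 ^ k).-1; first by rewrite prednK// expn_gt0.
  apply/cdyadicP; rewrite prednK ?expn_gt0// mul1r -natrX lexx andbT.
  by rewrite ler_nat leq_pred.
have [|i ik /dyadic_sub_cdyadic ix] := @dyadic_cover R k x; first by rewrite x0.
by exists i.
Qed.

Lemma measure_total (mu : {measure set R -> \bar R}) :
  (forall A, measurable A -> (mu A <= @lambda R A)%E) -> mu setT = (dyadic_mass mu 0 0)%:E.
Proof.
move=> mu_le; rewrite dyadic_massE//.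
have mI : measurable (`[0, 1[ : set R) by [].
have -> : dyadic R 0 0 = `[0, 1[%classic by rewrite /dyadic expr0 !divr1.
rewrite -[in LHS](setUv `[0, 1[%classic) measureU//.
- by rewrite [X in (_ + X)%E]le_lambda_out// adde0.
- exact: measurableC.
- exact: setICr.
Qed.

Lemma dyadic_mass_sum (mu : {measure set R -> \bar R}) n :
  (forall A, measurable A -> (mu A <= @lambda R A)%E) ->
  \sum_(i < 2 ^ n) dyadic_mass mu n i = dyadic_mass mu 0 0.
Proof.
move=> mu_le; rewrite -(sum_descendants n (dyadic_mass_split mu_le) (isT : 0 < 2 ^ 0)%N).
by apply: eq_bigl => i; rewrite divn_small ?eqxx.
Qed.

(** [alpha_nbhd] is applied to the union of the closed intervals indexed by [A]. Its neighborhood is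
    covered by the closed intervals whose boxes meet [S], and closing an interval does not change
    its mass. *)
Lemma dyadic_hall n :
  hall (fun i : 'I_(2 ^ n) => a n i) (fun j : 'I_(2 ^ n) => b n j)
    (fun i j => `[< meets n i j >]).
Proof.
move=> A; rewrite /slack subr_ge0.
pose U : set R := \bigcup_(i in [set` enum A]) cdyadic R n i.
have cU : closed U.
  by rewrite /U bigcup_seq; apply: closed_bigsetU => i _; exact: interval_closed.
have U1 : U `<=` @unit_itv R by move=> x [i _]; apply: cdyadic_sub_unit.
have : (alpha U <= beta (nbhd S U))%E by exact: alpha_nbhd.
have aU : ((\sum_(i in A) a n i)%:E <= alpha U)%E.
  rewrite -sumEFin -big_enum.
  rewrite (eq_big_seq (fun i : 'I_(2 ^ n) => alpha (dyadic R n i))); last first.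
    by move=> i _; rewrite dyadic_massE.
  apply: sum_measure_le => //.
  - exact: enum_uniq.
  - exact: closed_measurable.
  - move=> i iA; split; first exact: measurable_dyadic.
    by move=> x /dyadic_sub_cdyadic ix; exists i.
  - by move=> i j x ix jx; apply/val_inj; exact: dyadic_inj ix jx.
have bU : (beta (nbhd S U) <=
    (\sum_(j < 2 ^ n | [exists i in A, `[< meets n i j >]]) b n j)%:E)%E.
  rewrite -sumEFin -big_filter.
  rewrite (eq_big_seq (fun j : 'I_(2 ^ n) => beta (cdyadic R n j))); last first.
    by move=> j _; rewrite cdyadic_massE.
  apply: measure_le_sum => [|j _|y [x [i iA ix] Sxy]].
  - by apply: closed_measurable; exact: closed_nbhd.
  - exact: measurable_cdyadic.
  - have [j j2 jy] := cdyadic_cover n (hSsq Sxy).2.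
    exists (Ordinal j2) => //; rewrite mem_filter mem_index_enum andbT.
    apply/existsP; exists i; rewrite -mem_enum iA/=.
    by apply/asboolP; exists (x, y).
move=> UU; rewrite -lee_fin; exact: le_trans aU (le_trans UU bU).
Qed.

Lemma dyadic_plan n : exists w : nat -> nat -> R,
  [/\ forall i j, 0 <= w i j, forall i j, 0 < w i j -> meets n i j,
      forall i, (i < 2 ^ n)%N -> \sum_(j < 2 ^ n) w i j = a n i &
      forall j, (j < 2 ^ n)%N -> \sum_(i < 2 ^ n) w i j = b n j].
Proof.
have [|||m [m0 me ma mb]] := transportation _ _ _ (dyadic_hall (n := n)).
- by move=> i; exact: dyadic_mass_ge0.
- by move=> i; exact: dyadic_mass_ge0.
- rewrite !dyadic_mass_sum//; apply: EFin_inj.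
  by rewrite -!measure_total.
(* Extension by zero to all naturals gives the plans of all levels one type. *)
pose w i j := if insub i is Some i' then if insub j is Some j' then m i' j' else 0 else 0.
exists w; split=> [i j|i j|i i2|j j2]; rewrite /w.
- by case: insub => // i'; case: insub.
- case: insubP => [i' _ <-|]; last by rewrite ltxx.
  case: insubP => [j' _ <-|]; last by rewrite ltxx.
  by move=> /me/asboolP.
- rewrite -(ma (Ordinal i2)); apply: eq_bigr => j _.
  by rewrite insubT (insubT (fun x => x < 2 ^ n)%N (ltn_ord j)); congr (m _ _); apply/val_inj.
- rewrite -(mb (Ordinal j2)); apply: eq_bigr => i _.
  by rewrite (insubT (fun x => x < 2 ^ n)%N (ltn_ord i)) insubT; congr (m _ _); apply/val_inj.
Qed.

Theorem strassen : exists rho : {measure set (R * R)%type -> \bar R},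
  [/\ rho (~` S) = 0%E,
      forall A, measurable A -> rho (fst @^-1` A) = alpha A &
      forall A, measurable A -> rho (snd @^-1` A) = beta A].
Proof.
have [w wP] := choice dyadic_plan.
have [m [m0 ms me ma mb]] := @dyadic_limit R a b meets w
  (dyadic_mass_split alpha_le) (dyadic_mass_split beta_le) meets_half
  (fun n => let: And4 h _ _ _ := wP n in h) (fun n => let: And4 _ h _ _ := wP n in h)
  (fun n => let: And4 _ _ h _ := wP n in h) (fun n => let: And4 _ _ _ h := wP n in h).
have [rho [rhoT rho_ge]] := dyadic_measure m0 ms.
have m00 : m 0%N 0%N 0%N = a 0 0 by rewrite -ma// big_ord1.
(* With [f] one of the two projections: a marginal is determined by its total mass and lower bounds
   on dyadic unions. *)
have rhoE (f : R * R -> R) (mu : {measure set R -> \bar R}) :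
    (forall A, measurable A -> (mu A <= @lambda R A)%E) -> measurable_fun setT f ->
    rho setT = mu setT ->
    (forall k (P : nat -> bool) (B : set R), measurable B ->
      (forall i, (i < 2 ^ k)%N -> P i -> cdyadic R k i `<=` B) ->
      ((\sum_(i < 2 ^ k | P i) dyadic_mass mu k i)%:E <= rho (f @^-1` B))%E) ->
    forall A, measurable A -> rho (f @^-1` A) = mu A.
  move=> mu_le mf rhomu H A mA.
  unshelve epose (nu := (pushforward rho f : {measure set R -> \bar R})); first exact: mf.
  apply: (eq_of_dyadic_sums (nu := nu) mu_le) mA => //.
have rho_alpha : rho setT = alpha setT by rewrite rhoT m00 -measure_total.
exists rho; split.
(* The boxes of level [k] with positive mass carry all of [rho], and each of them meets [S]. *)
- pose Sk k := \bigcup_i \bigcup_(j in [set j | [&& (i < 2 ^ k)%N, (j < 2 ^ k)%N &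
    0 < m k i j]]) (cdyadic R k i `*` cdyadic R k j).
  have mSk k : measurable (Sk k).
    apply: bigcup_measurable => i _; apply: bigcup_measurable => j _.
    by apply: measurableX; exact: measurable_itv.
  have Sk0 k : rho (~` Sk k) = 0%E.
    have SkT : (rho setT <= rho (Sk k))%E.
      rewrite rhoT m00.
      have -> : a 0 0 = \sum_(p : 'I_(2 ^ k) * 'I_(2 ^ k) | 0 < m k p.1 p.2) m k p.1 p.2.
        rewrite -(dyadic_mass_sum k alpha_le) [RHS]big_mkcond/=.
        under [LHS]eq_bigr do rewrite -ma//.
        rewrite [LHS]pair_big/=; apply: eq_bigr => p _; case: ltP => // mle.
        by apply/le_anti; rewrite m0 mle.
      apply: (rho_ge k (fun i j => 0 < m k i j)) => // i j i2 j2 mij p pij.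
      by exists i => //; exists j => //=; rewrite i2 j2.
    have fin : rho (Sk k) \is a fin_num.
      rewrite ge0_fin_numE//; apply: le_lt_trans (_ : (rho setT < +oo)%E).
        by apply: le_measure; rewrite ?inE.
      by rewrite rhoT ltry.
    apply/eqP; rewrite -measure_le0 -(@leeD2rE _ (rho (Sk k)))// add0e.
    by rewrite addeC -measureU ?setICr ?setUv//; exact: measurableC.
  apply: measure_negligible; first by apply: measurableC; exact: closed_measurable_prod.
  apply: (@negligibleS _ _ _ _ (\bigcup_k ~` Sk k)); last first.
    by apply: negligible_bigcup => k; apply/negligibleP; [exact: measurableC|exact: Sk0].
  (* A point of every [Sk k] shares arbitrarily small closed boxes with points of [S], hence lies in
     the closed set [S]. *)
  move=> p nSp; apply: contrapT => nSk; apply: nSp; apply: hS => B.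
  move=> /nbhs_ballP[e /= e0 eB]; have [k ke] := exp2V_lt e0.
  have : Sk k p by apply: contrapT => nk; apply: nSk; exists k.
  move=> [i _ [j /= /and3P[i2 j2 mij] [pi pj]]].
  have [q [Sq [qi qj]]] := me _ _ _ mij.
  exists q; split=> //; apply: eB.
  have near (x y : R) l : cdyadic R k l x -> cdyadic R k l y -> ball x e y.
    move=> /cdyadicP/andP[x1 x2] /cdyadicP/andP[y1 y2]; rewrite /ball/=.
    have k0 : (0 : R) < 2 ^+ k by rewrite exprn_gt0.
    apply: le_lt_trans ke; rewrite -(ler_pM2r k0) mulVf ?gt_eqF//.
    rewrite -[X in _ * X](gtr0_norm k0) -normrM mulrBl ler_norml.
    by move: x1 x2 y1 y2; rewrite -natr1; lra.
  by split; [exact: near pi qi|exact: near pj qj].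
- apply: rhoE => //.
  move=> k P B mB PB.
  have -> : \sum_(i < 2 ^ k | P i) a k i =
      \sum_(p : 'I_(2 ^ k) * 'I_(2 ^ k) | P p.1) m k p.1 p.2.
    under eq_bigr do rewrite -ma//.
    by rewrite [LHS]pair_big/=; apply: eq_bigl => p; rewrite andbT.
  apply: (rho_ge k (fun i j => P i)).
    by rewrite -[X in measurable X]setTI; exact: measurable_fst.
  by move=> i j i2 j2 Pi p [/= pi _]; apply: (PB i).
- apply: rhoE => //; first by rewrite rho_alpha.
  move=> k P B mB PB.
  have -> : \sum_(i < 2 ^ k | P i) b k i =
      \sum_(p : 'I_(2 ^ k) * 'I_(2 ^ k) | P p.2) m k p.1 p.2.
    under eq_bigr do rewrite -mb//.
    by rewrite [LHS]exchange_big [LHS]pair_big/=; apply: eq_bigl => p.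
  apply: (rho_ge k (fun i j => P j)).
    by rewrite -[X in measurable X]setTI; exact: measurable_snd.
  by move=> i j i2 j2 Pj p [/= _ pj]; apply: (PB j).
Qed.

End Strassen.

(** * Compliance and shaving *)

Lemma probability_of_measure d (T : measurableType d) (R : realType)
    (mu : {measure set T -> \bar R}) (x : T) : mu setT = 1%E ->
  exists P : probability T R, forall A, P A = mu A.
Proof.
move=> mu1; exists (mnormalize mu (dirac x)) => A.
suff : mnormalize mu (dirac x) A = mu A by [].
by rewrite /mnormalize mu1 onee_eq0/= invr1 mule1.
Qed.

Lemma measure_difference d (T : measurableType d) (R : realType)
    (mu nu : {measure set T -> \bar R}) :
  (forall A, measurable A -> (nu A <= mu A)%E) -> (mu setT < +oo)%E ->
  exists kappa : {measure set T -> \bar R},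
    forall A, measurable A -> kappa A = (mu A - nu A)%E.
Proof.
move=> numu muoo.
have mufin A : measurable A -> mu A \is a fin_num.
  move=> mA; rewrite ge0_fin_numE//; apply: le_lt_trans muoo.
  by apply: le_measure; rewrite ?inE.
have nufin A : measurable A -> nu A \is a fin_num.
  move=> mA; rewrite ge0_fin_numE//; apply: le_lt_trans (numu _ mA) _.
  by rewrite -ge0_fin_numE// mufin.
(* A measure must be nonnegative on nonmeasurable sets too, where mu - nu need not be. *)
pose f A : \bar R := if `[< measurable A >] then (mu A - nu A)%E else 0%E.
have fE A : measurable A -> f A = (mu A - nu A)%E.
  by move=> mA; rewrite /f; case: asboolP.
have f0 : f set0 = 0%E by rewrite fE// !measure0 sube0.
have f_ge0 A : (0 <= f A)%E.
  by rewrite /f; case: asboolP => // mA; rewrite sube_ge0 ?nufin// numu.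
have f_sigma : semi_sigma_additive f.
  move=> F mF tF mUF; rewrite fE//.
  rewrite (_ : (fun n => _) = (fun n => \sum_(0 <= i < n) mu (F i) -
      \sum_(0 <= i < n) nu (F i))%E); last first.
    apply/funext => n.
    under eq_bigr do rewrite fE//.
    by rewrite big_split/= fin_num_sumeN// => i _; exact: nufin.
  apply: cvgeB.
  - by rewrite fin_num_adde_defl// fin_numN nufin.
  - exact: measure_semi_sigma_additive.
  - exact: measure_semi_sigma_additive.
pose m := isMeasure.Build _ _ _ f f0 f_ge0 f_sigma.
pose kappa : {measure set T -> \bar R} := HB.pack f m.
by exists kappa => A; exact: fE.
Qed.

(** An outer measure consults only measurable covers. A difference such as [lambda] minus a marginal
    can thus be replaced by a measure that agrees with it on Borel sets. *)
Lemma eq_mu_ext d (T : measurableType d) (R : realType) (f g : set T -> \bar R) :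
  (forall A, measurable A -> f A = g A) -> (f^*)%mu = (g^*)%mu.
Proof.
move=> fg; apply/funext => U; rewrite /mu_ext; congr ereal_inf.
apply/seteqP; split=> _ [A UA <-]; exists A => //; apply: eq_eseriesr => k _;
  rewrite fg//; by case: UA.
Qed.

Section Compliance.
Variables (R : realType) (S : set (R * R)).

Lemma closed_Lebesgue_measurable (U : set R) : closed U -> Lebesgue_measurable U.
Proof.
move=> cU; exists U; first exact: closed_measurable.
by exists set0; [exact: negligible_set0|rewrite setU0].
Qed.

(** Up to a [rho]-null set, whatever lies over [X] is in [S] and projects into the neighborhood of
    [X]. *)
Lemma marginals_compliant (rho : {measure set (R * R)%type -> \bar R})
    (f g : set R -> \bar R) : closed S -> rho (~` S) = 0%E ->
  (forall A, measurable A -> f A = rho (fst @^-1` A)) ->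
  (forall A, measurable A -> g A = rho (snd @^-1` A)) ->
  (forall A, measurable A -> (f A <= @lambda R A)%E) ->
  compliant S f g.
Proof.
move=> cS rhoS fE gE f_le U U1 [X mX [N [N' [mN' N'0 NN']] <-{U U1}]] _.
have mfst : measurable_fun setT (fst : R * R -> R) by exact: measurable_fst.
have msnd : measurable_fun setT (snd : R * R -> R) by exact: measurable_snd.
unshelve epose (a := (pushforward rho fst : {measure set R -> \bar R})); first exact: mfst.
unshelve epose (b := (pushforward rho snd : {measure set R -> \bar R})); first exact: msnd.
rewrite (eq_mu_ext (g := a))// (eq_mu_ext (f := g) (g := b))//.
(* [U] exceeds the Borel set [X] by a subset of [N'], which is null for [f] because [f] is at most
   [lambda]. *)
have aN' : a N' = 0%E.
  apply/eqP; rewrite -measure_le0; have := f_le _ mN'; rewrite fE// => /le_trans; apply.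
  by rewrite -N'0; exact: lambda_le_lebesgue.
apply: (@le_trans _ _ (a X)).
  apply: (@le_trans _ _ ((a^*)%mu (X `|` N'))); first by apply: le_mu_ext; exact: setUS.
  rewrite measurable_mu_extE; last exact: measurableU.
  rewrite -[leRHS]adde0 -aN'; exact: (measureU2 a mX mN').
(* The neighborhood of [U] need not be Borel, so the bound is proved for each measurable cover in
   the infimum that defines the outer measure. *)
apply/le_ereal_inf_tmp => _ [A [mA UA] <-].
have mUA : measurable (\bigcup_n A n) by exact: bigcup_measurable.
apply: (@le_trans _ _ (b (\bigcup_n A n))); last exact: measure_sigma_subadditive.
have mS : measurable (~` S) by apply: measurableC; exact: closed_measurable_prod.
have mB : measurable (snd @^-1` (\bigcup_n A n) : set (R * R)).
  by rewrite -[X in measurable X]setTI; exact: measurable_snd.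
have mA' : measurable (fst @^-1` X : set (R * R)).
  by rewrite -[X in measurable X]setTI; exact: measurable_fst.
suff : (rho (fst @^-1` X) <= rho (snd @^-1` (\bigcup_n A n)))%E by [].
rewrite -[leRHS]adde0 -[X in (_ + X)%E]rhoS.
apply: le_trans (measureU2 rho mB mS).
apply: le_measure; rewrite ?inE//; first exact: measurableU.
move=> [x y] /= Xx; have [Sxy|] := pselect (S (x, y)); [left|by right].
by apply: UA; exists x => //; left.
Qed.

End Compliance.

(** The weights [2 ^- (n + 1)] sum to one, which keeps a common value, and are positive, which lets
    the mixture inherit positivity from any term. *)
Lemma geometric_mixture d (T : measurableType d) (R : realType)
    (mu_ : nat -> {measure set T -> \bar R}) :
  exists mu : {measure set T -> \bar R},
    (forall A r, (forall n, mu_ n A = r%:E) -> mu A = r%:E) /\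
    forall A n, (0 < mu_ n A)%E -> (0 < mu A)%E.
Proof.
have w_gt0 n : 0 < ((2 ^ (n + 1))%N%:R^-1 : R) by rewrite invr_gt0 ltr0n expn_gt0.
pose w n : {nonneg R} := NngNum (ltW (w_gt0 n)).
exists (mseries (fun n => mscale (w n) (mu_ n)) 0); split=> A.
  move=> r mur; rewrite /= /mseries/= /mscale/=; apply/cvg_lim => //.
  rewrite -[X in _ --> X%:E](divr1 r) -(expr0 2).
  rewrite (_ : (fun n => _) = eseries (fun k => (r / (2 ^ (k + 1))%:R)%:E)).
    exact: cvg_geometric_eseries_half.
  apply/funext => n; apply: eq_bigr => k _.
  by rewrite mur -EFinM mulrC.
move=> n mun.
apply: (@lt_le_trans _ _ ((w n)%:num%:E * mu_ n A)%E).
  by rewrite mule_gt0// lte_fin; exact: w_gt0.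
apply: (@le_trans _ _ (\sum_(0 <= k < n.+1) mscale (w k) (mu_ k) A)%E).
  by rewrite big_nat_recr//= leeDr// sume_ge0.
exact: nneseries_lim_ge.
Qed.

(** * Cells with rational corners *)

Lemma interior_subspaceP (T : topologicalType) (A C : set T) (p : T) : A p ->
  interior (C : set (subspace A)) p <-> within A (nbhs p) C.
Proof. by move=> Ap; rewrite /interior/= nbhs_subspace_in. Qed.

Section Cells.
Variable R : realType.

Lemma measurable_cell (a b c d : R) : measurable (cell a b c d).
Proof. by apply: measurableX; exact: measurable_itv. Qed.

(** The length [s] is prescribed so that both sides of a cell can share it. The interval starts at
    [0] if [x < s], ends at [1] if [x > 1 - s], and otherwise has [x] in its interior; [h] is
    therefore a radius relative to the unit interval. *)
Lemma rat_itv_near (x e : R) (s : rat) : 0 <= x <= 1 -> 0 < (ratr s : R) < 1 ->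
  ratr s < e ->
  exists a : rat, [/\ 0 <= (ratr a : R), ratr (a + s) <= (1 : R),
    forall y, ratr a <= y <= ratr (a + s) -> `|x - y| < e &
    exists2 h, 0 < h & forall y, 0 <= y <= 1 -> `|x - y| < h -> ratr a <= y <= ratr (a + s)].
Proof.
move=> x01 s01 se.
suff [a [a0 a1 ax [h h0 hy]]] : exists a : rat, [/\ 0 <= (ratr a : R), ratr (a + s) <= (1 : R),
    ratr a <= x <= ratr (a + s) &
    exists2 h, 0 < h & forall y, 0 <= y <= 1 -> `|x - y| < h -> ratr a <= y <= ratr (a + s)].
  exists a; split=> // [y|]; last by exists h.
  by move: ax; rewrite rmorphD/= ltr_norml; lra.
have [xs|xs] := ltP x (ratr s).
  exists 0; rewrite add0r rmorph0; split; [by []|lra|lra|].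
  by exists (ratr s - x); [lra|move=> y y01; rewrite ltr_norml; lra].
have [sx|sx] := ltP (1 - ratr s) x.
  exists (1 - s); rewrite subrK rmorphB !rmorph1; split; [lra|by []|lra|].
  by exists (x - (1 - ratr s)); [lra|move=> y y01; rewrite ltr_norml; lra].
have [a /[!in_itv]/= /andP[a1 a2]] := @rat_in_itvoo R (x - ratr s) x ltac:(lra).
exists a; rewrite rmorphD/=; split; [lra|lra|lra|].
exists (Num.min (x - ratr a) (ratr a + ratr s - x)).
  by rewrite lt_min; apply/andP; split; lra.
by move=> y y01; rewrite lt_min !ltr_norml => /andP[]; lra.
Qed.

Lemma rat_cell_near (p : R * R) (V : set (R * R)) : unit_square p -> nbhs p V ->
  exists a b c d : rat,
    [/\ is_cell (ratr a : R) (ratr b) (ratr c) (ratr d),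
        cell (ratr a : R) (ratr b) (ratr c) (ratr d) `<=` V &
        interior (cell (ratr a) (ratr b) (ratr c) (ratr d) :
          set (subspace (@unit_square R))) p].
Proof.
move=> p01 /nbhs_ballP[e /= e0 eV].
(* The minimum with [1] lets an interval of length [s] fit into the unit interval. *)
have e1 : 0 < Num.min e 1 by rewrite lt_min e0 ltr01.
have [s /[!in_itv]/= /andP[s0]] := rat_in_itvoo e1.
rewrite lt_min => /andP[se s1].
have s01 : 0 < (ratr s : R) < 1 by rewrite s0.
have [p1 p2] := p01; move: p1 p2; rewrite /unit_itv/= !in_itv/= => p1 p2.
have [a [a0 a1 ae [h h0 ah]]] := rat_itv_near p1 s01 se.
have [c [c0 c1 ce [k k0 ck]]] := rat_itv_near p2 s01 se.
exists a, (a + s), c, (c + s); split.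
- move: a0 a1 c0 c1; rewrite !rmorphD/= => a0 a1 c0 c1.
  by split; [apply/and3P; split; lra|apply/and3P; split; lra|lra].
- move=> q [] /=; rewrite !in_itv/= => /ae ? /ce ?; apply: eV.
  by split; rewrite /ball/=.
- apply/interior_subspaceP => //; apply/nbhs_ballP.
  exists (Num.min h k); first by rewrite /= lt_min h0.
  move=> q []; rewrite /ball/= !lt_min => /andP[qh _] /andP[_ qk] [].
  rewrite /unit_itv/= !in_itv/= => q1 q2.
  by split; rewrite /= in_itv/=; [exact: ah|exact: ck].
Qed.

End Cells.

(* lambda is built on measurableTypeR R, whose display differs from that of R; moving
   it to R gives a term of the measure type over R. *)
Lemma lambda_measure (R : realType) :
  exists lam : {measure set R -> \bar R}, @lambda R = lam :> (set R -> \bar R).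
Proof.
unshelve epose (leb := (pushforward lebesgue_measure
    (idfun : measurableTypeR R -> R) : {measure set R -> \bar R})).
  by move=> _ Y mY; rewrite setTI.
by exists (mrestr leb (measurable_itv `[0, 1])).
Qed.

(** * Shavings and measures with uniform marginals *)

Section Shaving.
Variables (R : realType) (S C : set (R * R)).
Hypotheses (hS : closed S) (hSsq : S `<=` @unit_square R) (mC : measurable C).

(** A permuton carried by [S], kept as a plain measure so that sums and mixtures can be formed. *)
Definition uniform_on (mu : {measure set (R * R)%type -> \bar R}) : Prop :=
  [/\ mu (~` S) = 0%E,
      forall A, measurable A -> mu (fst @^-1` A) = @lambda R A &
      forall A, measurable A -> mu (snd @^-1` A) = @lambda R A].

Let measurable_fst_preimage (A : set R) : measurable A ->
  measurable (fst @^-1` A : set (R * R)).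
Proof. by move=> mA; rewrite -[X in measurable X]setTI; exact: measurable_fst. Qed.

Let measurable_snd_preimage (A : set R) : measurable A ->
  measurable (snd @^-1` A : set (R * R)).
Proof. by move=> mA; rewrite -[X in measurable X]setTI; exact: measurable_snd. Qed.

Lemma uniform_on_total mu : uniform_on mu -> mu setT = 1%E.
Proof. by move=> [_ muX _]; rewrite -lambda_setT -muX// preimage_setT. Qed.

(** The part of [mu] on [C] is shaved off. The part on the complement has the remaining marginals
    and lives on [S], so [marginals_compliant] applies to it. *)
Lemma shavable_of_uniform mu : uniform_on mu -> (0 < mu C)%E -> shavable S C.
Proof.
move=> muU muC; have muT := uniform_on_total muU; have [muS muX muY] := muU.
have muoo A : measurable A -> (mu A < +oo)%E.
  move=> mA; apply: (@le_lt_trans _ _ (mu setT)); last by rewrite muT ltry.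
  by apply: le_measure; rewrite ?inE.
have mS : measurable (~` S) by apply: measurableC; exact: closed_measurable_prod.
have mnC : measurable (~` C) by exact: measurableC.
have split (A : set (R * R)) : measurable A -> (mu A - mu (A `&` C) = mu (A `&` ~` C))%E.
  move=> mA; rewrite (measureDI mu mA mC) setDE addeK//.
  by rewrite ge0_fin_numE// muoo//; exact: measurableI.
exists (mfrestr mC (muoo _ mC)); split.
- rewrite /= /mfrestr /mrestr; apply: (subset_measure0 (B := ~` S)) => //.
    apply: measurableI => //; apply: measurableC; apply: measurableI => //.
    exact: closed_measurable_prod.
  by move=> p [nSC Cp] Sp; apply: nSC.
- by rewrite /= /mfrestr /mrestr setTI gt_eqF.
- move=> A mA; rewrite /Xmarginal /pushforward/= /mfrestr /mrestr -muX//.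
  apply: le_measure; rewrite ?inE//; last exact: measurable_fst_preimage.
  by apply: measurableI => //; exact: measurable_fst_preimage.
- move=> A mA; rewrite /Ymarginal /pushforward/= /mfrestr /mrestr -muY//.
  apply: le_measure; rewrite ?inE//; last exact: measurable_snd_preimage.
  by apply: measurableI => //; exact: measurable_snd_preimage.
- apply: (@marginals_compliant _ _ (mrestr mu mnC)) => //.
  + by rewrite /= /mrestr; apply: (subset_measure0 (B := ~` S)) => //; exact: measurableI.
  + move=> A mA; rewrite /Xmarginal /pushforward/= /mfrestr /mrestr -muX// split//.
    exact: measurable_fst_preimage.
  + move=> A mA; rewrite /Ymarginal /pushforward/= /mfrestr /mrestr -muY// split//.
    exact: measurable_snd_preimage.
  + move=> A mA; rewrite /Xmarginal /pushforward/= /mfrestr /mrestr leeBlDr.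
      by rewrite leeDl.
    rewrite ge0_fin_numE// muoo//; apply: measurableI => //.
    exact: measurable_fst_preimage.
Qed.

(** Strassen's theorem for the remaining marginals gives [nu] on [S]; adding [rho] restores uniform
    marginals. *)
Lemma uniform_of_shavable : shavable S C -> exists2 mu, uniform_on mu & (0 < mu C)%E.
Proof.
move=> [rho [rhoSC rho_neq0 rhoX rhoY comp]].
unshelve epose (rX := (pushforward rho fst : {measure set R -> \bar R})).
  exact: measurable_fst.
unshelve epose (rY := (pushforward rho snd : {measure set R -> \bar R})).
  exact: measurable_snd.
have [lam lamE] := lambda_measure R; rewrite lamE in rhoX rhoY comp.
have lamoo : (lam setT < +oo)%E by rewrite -lamE lambda_setT ltry.
have [alpha alphaE] := @measure_difference _ _ _ lam rX rhoX lamoo.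
have [beta betaE] := @measure_difference _ _ _ lam rY rhoY lamoo.
have le_lam (r k : {measure set R -> \bar R}) :
    (forall A, measurable A -> (r A <= lam A)%E) ->
    (forall A, measurable A -> k A = (lam A - r A)%E) ->
    forall A, measurable A -> (k A <= @lambda R A)%E.
  move=> rl kE A mA; rewrite lamE kE// leeBlDr ?leeDl//.
  by apply: le_lambda_fin mA; rewrite lamE.
have mS : measurable S by exact: closed_measurable_prod.
have [|||U cU U1|nu [nuS nuX nuY]] := @strassen R S alpha beta hS hSsq.
- exact: (le_lam rX).
- exact: (le_lam rY).
- by rewrite (alphaE _ measurableT) (betaE _ measurableT).
(* A closed set and its neighborhood are Borel, so the outer measures in [comp] reduce to [alpha]
   and [beta]. *)
- have := comp U U1 (closed_Lebesgue_measurable cU)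
    (closed_Lebesgue_measurable (closed_nbhd hS hSsq cU)).
  rewrite (eq_mu_ext (g := alpha)); last by move=> A mA; rewrite alphaE.
  rewrite (eq_mu_ext (f := (_ \- Ymarginal _)%E) (g := beta)); last first.
    by move=> A mA; rewrite betaE.
  rewrite !measurable_mu_extE//; apply: closed_measurable => //.
  exact: closed_nbhd.
have rhoS : rho (~` S) = 0%E.
  apply: (subset_measure0 (B := ~` (S `&` C))) => //; first exact: measurableC.
    by apply: measurableC; exact: measurableI.
  by move=> p nSp [].
pose mu : {measure set (R * R)%type -> \bar R} := measure_add rho nu.
have muE A : mu A = (rho A + nu A)%E by exact: measure_addE.
exists mu.
  split=> [|A mA|A mA]; rewrite muE.
  - by rewrite rhoS nuS adde0.
  - rewrite nuX// alphaE// addeC lamE subeK//.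
    by apply: (le_lambda_fin (alpha := rX)) mA; rewrite lamE.
  - rewrite nuY// betaE// addeC lamE subeK//.
    by apply: (le_lambda_fin (alpha := rY)) mA; rewrite lamE.
rewrite muE; apply: (@lt_le_trans _ _ (rho C)); last by rewrite leeDl.
(* [rho] lives on the part of [S] in [C], so it would be zero if [C] were null. *)
rewrite lt_neqAle measure_ge0 andbT; apply: contra rho_neq0 => /eqP rC.
have mnC : measurable (~` C) by exact: measurableC.
have -> : rho setT = (rho C + rho (~` C))%E by rewrite -measureU ?setICr ?setUv.
rewrite -rC add0e; apply/eqP.
apply: (subset_measure0 (B := ~` (S `&` C))) => //.
  by apply: measurableC; exact: measurableI.
by move=> p nCp [].
Qed.

End Shaving.

(** * The characterization of supports of permutons *)

Theorem theorem10 (R : realType) (S : set (R * R)) (hS : closed S)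
    (hSsq : S `<=` @unit_square R) :
  (exists mu : probability (R * R)%type R, is_permuton mu /\ msupport mu = S)
  <->
  (compliant S (@lambda R) (@lambda R) /\
   forall a b c d : rat,
     is_cell (ratr a : R) (ratr b) (ratr c) (ratr d) ->
     occupied S (cell (ratr a) (ratr b) (ratr c) (ratr d)) ->
     shavable S (cell (ratr a) (ratr b) (ratr c) (ratr d))).
Proof.
split.
  move=> [mu [[mu_sq muX muY] supp]].
  have muS : mu (~` S) = 0%E.
    (* A point outside the support lies in a rational box of measure zero, and there are countably
       many of these. *)
    pose B n := if mu (rat_box R n) == 0%E then rat_box R n else set0.
    apply: measure_negligible; first by apply: measurableC; exact: closed_measurable_prod.
    apply: (@negligibleS _ _ _ _ (\bigcup_n B n)); last first.
      apply: negligible_bigcup => n; apply/negligibleP; rewrite /B.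
        by case: ifP => // _; exact: measurable_rat_box.
      by case: ifP => [/eqP//|_]; rewrite measure0.
    move=> p; rewrite -supp => /existsNP[V /not_implyP[oV /not_implyP[Vp muV]]].
    have [n np nV] := rat_box_basis (open_nbhs_nbhs (conj oV Vp)).
    exists n => //; rewrite /B ifT//; apply/eqP.
    apply: (subset_measure0 (B := V)) => //.
    - exact: measurable_rat_box.
    - exact: open_measurable_prod.
    - by apply/eqP; move/negP: muV; rewrite lt0e measure_ge0 andbT negbK.
  have muU : uniform_on S mu by split.
  split.
    apply: (marginals_compliant (rho := mu)) => //.
    - by move=> A mA; rewrite -muX.
    - by move=> A mA; rewrite -muY.
  move=> a b c d _ [p [Sp Cp]].
  apply: (shavable_of_uniform hS (measurable_cell _ _ _ _) muU).
  (* The interior in [occupied] is relative to the square: [U] is open in the plane, its part in the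
     square lies in [C], and its part off the square is null. *)
  set C := cell _ _ _ _; pose U := interior [set q | unit_square q -> C q].
  have oU : open U by exact: open_interior.
  have UC q : U q -> unit_square q -> C q by move=> /interior_subset; exact.
  have Up : U p by apply/(interior_subspaceP (A := @unit_square R)) => //; exact: hSsq.
  move: Sp; rewrite -supp => /(_ _ oU Up) => /lt_le_trans; apply.
  have msq : measurable (@unit_square R) by apply: measurableX; exact: measurable_itv.
  have mB := open_measurable_prod oU.
  rewrite (measureDI mu mB msq) -[leRHS]add0e leeD//.
    rewrite -mu_sq; apply: le_measure; rewrite ?inE; [exact: measurableD|exact: measurableC|].
    by move=> q [].
  apply: le_measure; rewrite ?inE; [exact: measurableI|exact: measurable_cell|].
  by move=> q [/UC].
move=> [comp shave].
have cell_uniform (p : R * R) V : S p -> nbhs p V -> exists a b c d : rat,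
    [/\ is_cell (ratr a : R) (ratr b) (ratr c) (ratr d),
        occupied S (cell (ratr a) (ratr b) (ratr c) (ratr d)),
        cell (ratr a : R) (ratr b) (ratr c) (ratr d) `<=` V &
        exists2 mu, uniform_on S mu & (0 < mu (cell (ratr a) (ratr b) (ratr c) (ratr d)))%E].
  move=> Sp pV; have [a [b [c [d [isC CV Cp]]]]] := rat_cell_near (hSsq _ Sp) pV.
  have oC : occupied S (cell (ratr a : R) (ratr b) (ratr c) (ratr d)) by exists p.
  exists a, b, c, d; split=> //.
  by apply: (uniform_of_shavable hS hSsq (measurable_cell _ _ _ _)); exact: shave.
(* For empty [S], compliance on the whole unit interval would read [1 <= 0]. The point found yields
   the default measure [nu0]. *)
have [p0 Sp0] : S !=set0.
  apply/set0P/negP => /eqP S0.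
  have N0 : nbhd S (@unit_itv R) = set0.
    by rewrite S0; apply/seteqP; split=> // y [].
  have c01 : closed (@unit_itv R) by exact: interval_closed.
  have := comp _ (@subset_refl _ _) (closed_Lebesgue_measurable c01).
  rewrite N0 => /(_ (closed_Lebesgue_measurable closed0)).
  have [lam lamE] := lambda_measure R.
  rewrite lamE !measurable_mu_extE ?measure0//; last exact: measurable_itv.
  rewrite -lamE /lambda /mrestr setIid lebesgue_measure_itv/= lte01 sube0.
  by rewrite leNgt lte01.
have [_ [_ [_ [_ [_ _ _ [nu0 nu0U _]]]]]] := cell_uniform p0 setT Sp0 filterT.
(* If [n] codes an occupied rational cell, the measure charges that cell; all other numbers get
   [nu0]. *)
have ex_nu n : exists nu : {measure set (R * R)%type -> \bar R},
    uniform_on S nu /\ forall a b c d : rat,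
      unpickle n = Some (a, b, c, d) ->
      is_cell (ratr a : R) (ratr b) (ratr c) (ratr d) ->
      occupied S (cell (ratr a) (ratr b) (ratr c) (ratr d)) ->
      (0 < nu (cell (ratr a) (ratr b) (ratr c) (ratr d)))%E.
  have [[[[[a b] c] d] nE]|nN] :=
      pselect (exists q : rat * rat * rat * rat, unpickle n = Some q); last first.
    by exists nu0; split=> // a b c d nE; case: nN; exists (a, b, c, d).
  have [[isC oC]|nC] := pselect (is_cell (ratr a : R) (ratr b) (ratr c) (ratr d) /\
      occupied S (cell (ratr a : R) (ratr b) (ratr c) (ratr d))); last first.
    by exists nu0; split=> // a' b' c' d'; rewrite nE => -[<- <- <- <-] *; case: nC.
  have [mu muU muC] :=
    uniform_of_shavable hS hSsq (measurable_cell _ _ _ _) (shave _ _ _ _ isC oC).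
  by exists mu; split=> // a' b' c' d'; rewrite nE => -[<- <- <- <-].
have [nu nuP] := choice ex_nu.
have [mu [mu_cst mu_gt0]] := geometric_mixture nu.
(* [geometric_mixture] preserves common values that are real numbers, so [lambda] must be finite. *)
have lam_fin A : measurable A -> @lambda R A \is a fin_num.
  by have [lam lamE] := lambda_measure R; rewrite lamE; apply: le_lambda_fin; rewrite lamE.
have muU : uniform_on S mu.
  split=> [|A mA|A mA].
  - by apply: mu_cst => n; have [[]] := nuP n.
  - rewrite -(fineK (lam_fin _ mA)); apply: mu_cst => n.
    by have [[_ -> //]] := nuP n; rewrite fineK// lam_fin.
  - rewrite -(fineK (lam_fin _ mA)); apply: mu_cst => n.
    by have [[_ _ -> //]] := nuP n; rewrite fineK// lam_fin.
have [P PE] := probability_of_measure p0 (uniform_on_total muU).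
have [muS muX muY] := muU.
have mS : measurable S by exact: closed_measurable_prod.
exists P; split.
  split=> [|A mA|A mA].
  - rewrite PE; apply: (subset_measure0 (B := ~` S)) => //.
    + by apply: measurableC; apply: measurableX; exact: measurable_itv.
    + exact: measurableC.
    + by move=> q nq Sq; apply: nq; exact: hSsq.
  - by rewrite /Xmarginal /pushforward PE muX.
  - by rewrite /Ymarginal /pushforward PE muY.
apply/seteqP; split=> p.
  move=> suppp; apply: contrapT => nSp.
  by have := suppp _ (closed_openC hS) nSp; rewrite PE muS ltxx.
(* [V] contains an occupied rational cell, which is charged by the term of the mixture with its
   code. *)
move=> Sp V oV Vp; rewrite PE.
have [a [b [c [d [isC oC CV _]]]]] := cell_uniform p V Sp (open_nbhs_nbhs (conj oV Vp)).
apply: (@lt_le_trans _ _ (mu (cell (ratr a) (ratr b) (ratr c) (ratr d)))).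
  apply: (mu_gt0 _ (pickle (a, b, c, d))).
  by apply: (nuP _).2 => //; rewrite pickleK.
apply: le_measure; rewrite ?inE//; [exact: measurable_cell|exact: open_measurable_prod].
Qed.
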